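(* Suppose $\mathcal{A}$ is a unital separable approximately divisible C$^*$-algebra generated by self-adjoint elements $x_1,\ldots,x_n$. Then $$\delta_{top}(x_1,\ldots,x_n)\le 1.$$
   Context: Approximate divisibility. For a finite-dimensional C$^*$-algebra $\mathcal{B}\cong M_{k_1}(\mathbb{C})\oplus\cdots\oplus M_{k_r}(\mathbb{C})$, define $\mathrm{SubRank}(\mathcal{B})=\min\{k_1,\ldots,k_r\}$. A separable unital C$^*$-algebra $\mathcal{A}$ with unit $I_{\mathcal{A}}$ is approximately divisible if, for every $x_1,\ldots,x_n\in\mathcal{A}$ and $\varepsilon>0$, there is a finite-dimensional C$^*$-subalgebra $\mathcal{B}$ of $\mathcal{A}$ such that (1) $I_{\mathcal{A}}\in\mathcal{B}$; (2) $\mathrm{SubRank}(\mathcal{B})\ge 2$; (3) $\|x_iy-yx_i\|<\varepsilon$ for $i=1,\ldots,n$ and all $y\in\mathcal{B}$ with $\|y\|\le 1$. Topological free entropy dimension. Let $M_k^{s.a}(\mathbb{C})$ be the set of self-adjoint $k\times k$ complex matrices. On $M_k(\mathbb{C})^n$ use the norm $\|(A_1,\ldots,A_n)\|=\max_i\|A_i\|$ (operator norms). For $\mathcal{F}\subseteq M_k(\mathbb{C})^n$ and $\omega>0$, the covering number $\nu_\infty(\mathcal{F},\omega)$ is the minimal number of open $\omega$-balls in this norm whose union covers $\mathcal{F}$. Let $\{p_m\}_{m=1}^\infty$ be an enumeration of all noncommutative polynomials in $\mathbb{C}\langle X_1,\ldots,X_n\rangle$ whose coefficients have rational real and imaginary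 parts. For self-adjoint elements $x_1,\ldots,x_n$ of a unital C$^*$-algebra, $\varepsilon>0$ and positive integers $k,m$, let $$\Gamma_{top}(x_1,\ldots,x_n;k,\varepsilon,m)=\{(A_1,\ldots,A_n)\in (M_k^{s.a}(\mathbb{C}))^n:\ |\,\|p_j(A_1,\ldots,A_n)\|-\|p_j(x_1,\ldots,x_n)\|\,|<\varepsilon,\ 1\le j\le m\}.$$ Define $$\delta_{top}(x_1,\ldots,x_n;\omega)=\inf_{\varepsilon>0,\,m\in\mathbb{N}}\ \limsup_{k\to\infty}\frac{\log \nu_\infty(\Gamma_{top}(x_1,\ldots,x_n;k,\varepsilon,m),\omega)}{-k^2\log\omega},\qquad \delta_{top}(x_1,\ldots,x_n)=\limsup_{\omega\to0^+}\delta_{top}(x_1,\ldots,x_n;\omega),$$ with $\log 0=-\infty$. *)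

(* Defs.v *)
From HB Require Import structures.
From mathcomp Require Import all_boot all_order all_algebra.
From mathcomp Require Import finmap.
From mathcomp Require Import all_classical all_reals all_analysis.
From mathcomp Require Import complex.
(* The notations of monalg clash with those of mathcomp-analysis. *)
From mathcomp Require Import -(notations) monalg.

Set Implicit Arguments.
Unset Strict Implicit.
Unset Printing Implicit Defensive.

Import Order.TTheory GRing.Theory Num.Theory.
Import numFieldNormedType.Exports.

Local Open Scope classical_set_scope.
Local Open Scope ring_scope.
Local Open Scope sesquilinear_scope.

(* Unital C*-algebras. A structure inheriting from both the normed modules and
   the rings would clash with numDomainType, so the product is part of the
   mixin, and the algType structure is derived from it just below. The zero
   algebra is excluded, as for every algType. *)
HB.mixin Record isCStarAlgebra (R : realType) (A : Type)
    of CompleteNormedModule R[i] A := {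
  cone : A;
  cmul : A -> A -> A;
  star : A -> A;
  cmulA : associative cmul;
  cmul1l : left_id cone cmul;
  cmul1r : right_id cone cmul;
  cmulDl : left_distributive cmul +%R;
  cmulDr : right_distributive cmul +%R;
  cmulZl : forall (c : R[i]) (a b : A), c *: cmul a b = cmul (c *: a) b;
  cmulZr : forall (c : R[i]) (a b : A), c *: cmul a b = cmul a (c *: b);
  cone_neq0 : cone != 0;
  starD : {morph star : a b / a + b};
  starZ : forall (c : R[i]) (a : A), star (c *: a) = c^* *: star a;
  starM : forall a b : A, star (cmul a b) = cmul (star b) (star a);
  starK : involutive star;
  cnormM_le : forall a b : A, `|cmul a b| <= `|a| * `|b|;
  cstar_identity : forall a : A, `|cmul (star a) a| = `|a| ^+ 2
}.

#[short(type="cstarType")]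
HB.structure Definition CStarAlgebra (R : realType) :=
  {A of CompleteNormedModule R[i] A & isCStarAlgebra R A}.

HB.instance Definition _ (R : realType) (A : cstarType R) :=
  GRing.Zmodule_isNzRing.Build (CStarAlgebra.sort A)
    cmulA cmul1l cmul1r cmulDl cmulDr cone_neq0.
HB.instance Definition _ (R : realType) (A : cstarType R) :=
  GRing.Lmodule_isLalgebra.Build R[i] (CStarAlgebra.sort A) cmulZl.
HB.instance Definition _ (R : realType) (A : cstarType R) :=
  GRing.Lalgebra_isAlgebra.Build R[i] (CStarAlgebra.sort A) cmulZr.

(* `|a| lives in R[i] (as a nonnegative real); cnorm a is the same in R. *)
Definition cnorm (R : realType) (A : cstarType R) (a : A) : R :=
  complex.Re `|a|.

Definition separable (T : topologicalType) : Prop :=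
  exists2 D : set T, countable D & dense D.

(* C*-subalgebras, not necessarily sharing the unit of A. *)
Definition is_csubalgebra (R : realType) (A : cstarType R) (B : set A) : Prop :=
  [/\ B 0 /\ (forall a b : A, B a -> B b -> B (a + b)),
      forall (c : R[i]) (a : A), B a -> B (c *: a),
      forall a b : A, B a -> B b -> B (a * b),
      forall a : A, B a -> B (star a)
    & closed B].

Definition is_finite_dim (R : realType) (A : cstarType R) (B : set A) : Prop :=
  exists (d : nat) (e : 'I_d -> A),
    forall b, B b -> exists c : 'I_d -> R[i], b = \sum_(i < d) c i *: e i.

(* f is a *-isomorphism of M_(k 0) (+) ... (+) M_(k (r-1)) onto B. *)
Definition is_matrix_sum_iso (R : realType) (A : cstarType R) (B : set A)
    (r : nat) (k : 'I_r -> nat) (f : (forall i, 'M[R[i]]_(k i)) -> A) : Prop :=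
  [/\ forall (c : R[i]) (M N : forall i, 'M[R[i]]_(k i)),
        f (fun i => c *: M i + N i) = c *: f M + f N,
      forall M N, f (fun i => M i *m N i) = f M * f N,
      forall M, f (fun i => (M i) ^t Num.conj) = star (f M),
      injective f
    & range f = B].

(* min {k_1, ..., k_r} for any decomposition of B into matrix blocks; the
   default value 0 is only taken when B has no such decomposition. *)
Definition SubRank (R : realType) (A : cstarType R) (B : set A) : nat :=
  xget 0%N [set s : nat | exists (r : nat) (k : 'I_r.+1 -> nat)
                              (f : (forall i, 'M[R[i]]_(k i)) -> A),
    [/\ forall i, (0 < k i)%N, is_matrix_sum_iso B f
      & s = \big[minn/k ord0]_(i < r.+1) k i]].

Definition approximately_divisible (R : realType) (A : cstarType R) : Prop :=
  forall (m : nat) (a : 'I_m -> A) (e : R), 0 < e ->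
  exists B : set A,
    [/\ is_csubalgebra B, is_finite_dim B, B 1, (2 <= SubRank B)%N
      & forall (i : 'I_m) (b : A), B b -> cnorm b <= 1 ->
          cnorm (a i * b - b * a i) < e].

(* Generation as a unital C*-algebra. *)
Definition generated_by (R : realType) (A : cstarType R) (n : nat)
    (x : 'I_n -> A) : Prop :=
  smallest [set B : set A | is_csubalgebra B /\ B 1] (range x) = [set: A].

(* C<X_1, ..., X_n>: the algebra of the free monoid on 'I_n. *)
Definition ncpoly (R : realType) (n : nat) := malg (fmonom 'I_n) R[i].

Definition nceval (R : realType) (n : nat) (A : algType R[i]) (x : 'I_n -> A)
    (p : ncpoly R n) : A :=
  mmap (in_alg A) (fun w : fmonom 'I_n => \prod_(i <- w) x i) p.

Definition rational_ncpoly (R : realType) (n : nat) : set (ncpoly R n) :=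
  [set p | forall w : fmonom 'I_n, exists a b : rat,
     mcoeff w p = Complex (ratr a) (ratr b)].
Arguments rational_ncpoly : clear implicits.

Definition l2norm (R : realType) (k : nat) (v : 'cV[R[i]]_k) : R :=
  Num.sqrt (\sum_(i < k)
    (complex.Re (v i ord0) ^+ 2 + complex.Im (v i ord0) ^+ 2)).

(* The norm `|M| of mathcomp-analysis is the largest modulus of an entry, not
   the operator norm. *)
Definition opnorm (R : realType) (k : nat) (M : 'M[R[i]]_k) : R :=
  sup [set l2norm (M *m v) | v in [set v : 'cV[R[i]]_k | l2norm v <= 1]].

Definition opnorm_tuple (R : realType) (n k : nat)
    (M : 'I_n -> 'M[R[i]]_k) : R :=
  \big[Num.max/0]_(i < n) opnorm (M i).

(* +oo when F has no finite cover. *)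
Definition covering_number (R : realType) (n k : nat)
    (F : set ('I_n -> 'M[R[i]]_k)) (w : R) : \bar R :=
  ereal_inf [set (N%:R)%:E | N in [set N : nat |
    exists c : 'I_N -> ('I_n -> 'M[R[i]]_k),
      F `<=` \bigcup_j [set M | opnorm_tuple (fun i => M i - c j i) < w]]].

(* Matrices have size k.+1, so that they form an algType. The enumeration p
   starts at index 0: the first m polynomials are p 0, ..., p m.-1. *)
Definition Gamma_top (R : realType) (n : nat) (p : nat -> ncpoly R n)
    (A : cstarType R) (x : 'I_n -> A) (k : nat) (e : R) (m : nat)
    : set ('I_n -> 'M[R[i]]_k.+1) :=
  [set M | (forall i, M i \is hermsymmx) /\
     forall j : nat, (j < m)%N ->
       `|opnorm (nceval M (p j)) - cnorm (nceval x (p j))| < e].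
Arguments Gamma_top {R n} p {A} x k e m _.

Definition delta_top_at (R : realType) (n : nat) (p : nat -> ncpoly R n)
    (A : cstarType R) (x : 'I_n -> A) (w : R) : \bar R :=
  ereal_inf
    [set limn_esup (fun k : nat =>
           (lne (covering_number (Gamma_top p x k em.1 em.2) w)
            * ((- (k.+1%:R ^+ 2 * ln w))^-1)%:E)%E)
    | em in [set em : R * nat | 0 < em.1 /\ (0 < em.2)%N]].

Definition delta_top (R : realType) (n : nat) (p : nat -> ncpoly R n)
    (A : cstarType R) (x : 'I_n -> A) : \bar R :=
  limf_esup (delta_top_at p x) 0^'+.

(* Main.v *)
Require Import Defs.
From mathcomp Require Import all_boot all_order all_algebra.
From mathcomp Require Import all_classical all_reals all_analysis.
From mathcomp Require Import complex.
From mathcomp Require Import -(notations) monalg.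
From mathcomp Require Import ring lra zify.

(** The bound is a count of parameters.

    Fix [N = 2 ^ t].  Applying approximate divisibility [t] times yields in [A]
    a finite partition of unity [g] by almost projections which almost commute
    with the generators, and each of which has [N] almost isometric, almost
    orthogonal copies (exists_almost_central_partition).  The number of pieces
    depends on [t] only, so all the errors can be taken small afterwards.  The
    members of this partition are limits of rational polynomials in the
    generators (rational_polys_dense), hence finitely many norm conditions
    force every microstate [M] of size [k] to contain matrices satisfying the
    same relations up to a small error (polynomial_partition,
    microstate_norm_le).

    In [M_k] such almost projections are close to the spectral projections of
    a single Hermitian matrix (almost_partition_of_unity); their ranks are at
    most [k / N], because [N] independent copies of the range fit into [C^k]
    (block_size_le); and a matrix which almost commutes with them is almost
    block diagonal (block_compression).  So each [M i] is close to
    [U Y_i U^*] with one unitary [U] and block diagonal [Y_i], the blocks having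
    size at most [k / N] (microstate_blocks).

    The unitary contributes [k ^ 2] real parameters: it is a Lipschitz function
    of a Hermitian contraction (unitary_cayley_sqr, cayley_sqr_lipschitz).  The
    [n] block diagonal matrices contribute at most [2 n k ^ 2 / N].  Since the
    unit ball of any norm on [R ^ D] has a [delta]-net of at most
    [ceil (6 / delta) ^ D] points (internal_net), the logarithm of the covering
    number at scale [omega] is at most
    [k ^ 2 (1 + 2 n / N) ln (C / omega) + O(k)], where [C] depends neither on
    [N] nor on [omega], and the term [O(k)] counts the possible block patterns.
    Letting [k] and [N] go to infinity, then [omega] to 0, gives the bound 1. *)

Set Implicit Arguments.
Unset Strict Implicit.
Unset Printing Implicit Defensive.

Import Order.TTheory GRing.Theory Num.Theory.
Import numFieldNormedType.Exports.

Local Open Scope classical_set_scope.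
Local Open Scope ring_scope.
Local Open Scope sesquilinear_scope.

(** * The operator norm of complex matrices *)

Local Notation adj M := (M ^t Num.conj).

Section OperatorNorm.
Variable R : realType.
Local Notation C := R[i].
Local Notation toC := (real_complex R).

Lemma adjM m n p (A : 'M[C]_(m, n)) (B : 'M[C]_(n, p)) :
  adj (A *m B) = adj B *m adj A.
Proof. by rewrite trmx_mul map_mxM. Qed.

Lemma adjMr k (A B : 'M[C]_k.+1) : adj (A * B) = adj B * adj A.
Proof. exact: adjM. Qed.

Lemma adjD m n (A B : 'M[C]_(m, n)) : adj (A + B) = adj A + adj B.
Proof. by rewrite linearD /= map_mxD. Qed.

Lemma adjK m n (A : 'M[C]_(m, n)) : adj (adj A) = A.
Proof. exact: trmxCK. Qed.

Lemma normc2E (z : C) : `|z| ^+ 2 = toC (complex.Re z ^+ 2 + complex.Im z ^+ 2).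
Proof. by rewrite add_Re2_Im2. Qed.

Lemma ReC (z : C) : toC (complex.Re `|z|) = `|z|.
Proof. by rewrite RRe_real ?normr_real. Qed.

Lemma Re_normC_ge0 (z : C) : 0 <= complex.Re `|z|.
Proof. by rewrite -ler0c ReC normr_ge0. Qed.

Lemma l2norm_sqr k (v : 'cV[C]_k) : toC (l2norm v ^+ 2) = \sum_i `|v i ord0| ^+ 2.
Proof.
rewrite sqr_sqrtr; last by apply: sumr_ge0 => i _; rewrite addr_ge0 ?sqr_ge0.
by rewrite rmorph_sum; apply: eq_bigr => i _; rewrite normc2E.
Qed.

Lemma l2norm_adj k (v : 'cV[C]_k) : toC (l2norm v ^+ 2) = (adj v *m v) ord0 ord0.
Proof.
by rewrite l2norm_sqr mxE; apply: eq_bigr => i _; rewrite !mxE normCKC.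
Qed.

Lemma l2norm_ge0 k (v : 'cV[C]_k) : 0 <= l2norm v.
Proof. exact: sqrtr_ge0. Qed.

(** The triangle inequality is that of the Hermitian inner product on rows. *)
Lemma l2norm_dotmx k (v : 'cV[C]_k) : toC (l2norm v) = sqrtC (dotmx v^T v^T).
Proof.
have -> : dotmx v^T v^T = toC (l2norm v) ^+ 2.
  rewrite dotmxE; have := l2norm_sqr v; rewrite rmorphXn /= => ->; rewrite mxE;
    apply: eq_bigr => i _.
  by rewrite !mxE normCK.
by rewrite sqrCK // ler0c l2norm_ge0.
Qed.

Lemma l2normD k (u v : 'cV[C]_k) : l2norm (u + v) <= l2norm u + l2norm v.
Proof.
rewrite -lecR rmorphD /= !l2norm_dotmx linearD /=.
by have [] := triangle_lerif (@dotmx C k) u^T v^T.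
Qed.

Lemma l2norm_eq_sqr k l (u : 'cV[C]_k) (v : 'cV[C]_l) :
  toC (l2norm u ^+ 2) = toC (l2norm v ^+ 2) -> l2norm u = l2norm v.
Proof.
by move=> [] /eqP; rewrite eqrXn2 ?l2norm_ge0 // => /eqP.
Qed.

Lemma l2normZ k (a : C) (v : 'cV[C]_k) : l2norm (a *: v) = complex.Re `|a| * l2norm v.
Proof.
have a0 := Re_normC_ge0 a.
apply/eqP; rewrite -(@eqrXn2 _ 2) ?mulr_ge0 ?l2norm_ge0 //; apply/eqP/(@complexI R).
rewrite l2norm_sqr exprMn rmorphM /= l2norm_sqr mulr_sumr rmorphXn /= ReC.
by apply: eq_bigr => i _; rewrite mxE normrM exprMn.
Qed.

Lemma l2norm0 k : l2norm (0 : 'cV[C]_k) = 0.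
Proof. by rewrite -(scale0r 0) l2normZ normr0 mul0r. Qed.

Lemma l2normN k (v : 'cV[C]_k) : l2norm (- v) = l2norm v.
Proof. by rewrite -scaleN1r l2normZ normrN normr1 mul1r. Qed.

Lemma l2norm_sum k (I : Type) (r : seq I) (P : pred I) (F : I -> 'cV[C]_k) :
  l2norm (\sum_(i <- r | P i) F i) <= \sum_(i <- r | P i) l2norm (F i).
Proof.
elim/big_ind2 : _ => [|u u' v v' h1 h2|//]; first by rewrite l2norm0.
exact: le_trans (l2normD _ _) (lerD h1 h2).
Qed.

Lemma l2norm_eq0 k (v : 'cV[C]_k) : l2norm v = 0 -> v = 0.
Proof.
move=> v0; apply/colP => i; have := l2norm_sqr v; rewrite v0 expr0n /= => /esym/eqP.
rewrite psumr_eq0 => [|j _]; last by rewrite exprn_ge0.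
by move=> /allP /(_ i (mem_index_enum _)) /=; rewrite sqrf_eq0 normr_eq0 mxE => /eqP.
Qed.

Lemma l2norm_coord k (v : 'cV[C]_k) i : complex.Re `|v i ord0| <= l2norm v.
Proof.
have a0 := Re_normC_ge0 (v i ord0).
rewrite -(@ler_pXn2r _ 2) ?nnegrE ?l2norm_ge0 // -lecR l2norm_sqr rmorphXn /= ReC.
by rewrite (bigD1 i) //= lerDl sumr_ge0 // => j _; rewrite exprn_ge0.
Qed.

Lemma l2norm_delta k (a : 'I_k) : l2norm (delta_mx a ord0 : 'cV[C]_k) = 1.
Proof.
apply/eqP; rewrite -(@eqrXn2 _ 2) ?l2norm_ge0 //; apply/eqP/(@complexI R).
rewrite l2norm_sqr (bigD1 a) //= big1 => [|i ia].
  by rewrite mxE !eqxx normr1 !expr1n addr0.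
by rewrite mxE (negbTE ia) normr0 expr0n.
Qed.

Lemma l2norm_isometry m k (U : 'M[C]_(m, k)) v :
  adj U *m U = 1%:M -> l2norm (U *m v) = l2norm v.
Proof.
move=> UU; apply: l2norm_eq_sqr.
by rewrite !l2norm_adj adjM -mulmxA (mulmxA (adj U)) UU mul1mx.
Qed.

Lemma opnorm_set_bounded k (M : 'M[C]_k) :
  has_ubound [set l2norm (M *m v) | v in [set v : 'cV[C]_k | l2norm v <= 1]].
Proof.
exists (\sum_j l2norm (col j M)) => _ [v /= v1 <-].
have -> : M *m v = \sum_j v j ord0 *: col j M.
  by apply/colP => i; rewrite mxE summxE; apply: eq_bigr => j _; rewrite !mxE mulrC.
apply: le_trans (l2norm_sum _ _ _) _; apply: ler_sum => j _.
by rewrite l2normZ ler_piMl ?l2norm_ge0 // (le_trans (l2norm_coord _ _)).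
Qed.

Lemma opnorm_ge0 k (M : 'M[C]_k) : 0 <= opnorm M.
Proof.
apply: (ub_le_sup (opnorm_set_bounded M)).
by exists 0; rewrite /= ?mulmx0 l2norm0.
Qed.

Lemma opnormP k (M : 'M[C]_k) v : l2norm (M *m v) <= opnorm M * l2norm v.
Proof.
have [/l2norm_eq0 ->|v0] := eqVneq (l2norm v) 0; first by rewrite mulmx0 !l2norm0 mulr0.
have v_gt0 : 0 < l2norm v by rewrite lt_def v0 l2norm_ge0.
have nrm : complex.Re `|toC (l2norm v)^-1| = (l2norm v)^-1.
  by rewrite ger0_norm // ler0c invr_ge0 l2norm_ge0.
rewrite -ler_pdivrMr // mulrC -nrm -l2normZ scalemxAr.
apply: (ub_le_sup (opnorm_set_bounded M)); exists (toC (l2norm v)^-1 *: v) => //=.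
by rewrite l2normZ nrm mulVf.
Qed.

Lemma opnorm_le k (M : 'M[C]_k) c : 0 <= c ->
  (forall v, l2norm (M *m v) <= c * l2norm v) -> opnorm M <= c.
Proof.
move=> c0 Mc; apply: ge_sup => [|_ [v /= v1 <-]].
  by exists 0, 0; rewrite /= ?mulmx0 l2norm0.
by apply: le_trans (Mc v) _; rewrite ler_piMr.
Qed.

Lemma opnormD k (M N : 'M[C]_k) : opnorm (M + N) <= opnorm M + opnorm N.
Proof.
apply: opnorm_le => [|v]; first by rewrite addr_ge0 ?opnorm_ge0.
by rewrite mulmxDl mulrDl (le_trans (l2normD _ _)) // lerD ?opnormP.
Qed.

Lemma opnormM k (M N : 'M[C]_k) : opnorm (M *m N) <= opnorm M * opnorm N.
Proof.
apply: opnorm_le => [|v]; first by rewrite mulr_ge0 ?opnorm_ge0.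
rewrite -mulmxA (le_trans (opnormP _ _)) // -mulrA ler_wpM2l ?opnorm_ge0 //.
exact: opnormP.
Qed.

Lemma opnorm0 k : opnorm (0 : 'M[C]_k) = 0.
Proof.
apply/eqP; rewrite eq_le opnorm_ge0 andbT; apply: opnorm_le => // v.
by rewrite mul0mx l2norm0 mul0r.
Qed.

Lemma opnormZ_le k a (M : 'M[C]_k) : opnorm (a *: M) <= complex.Re `|a| * opnorm M.
Proof.
have a0 := Re_normC_ge0 a.
apply: opnorm_le => [|v]; first by rewrite mulr_ge0 ?opnorm_ge0.
by rewrite -scalemxAl l2normZ -mulrA ler_wpM2l ?opnormP.
Qed.

Lemma opnormZ k a (M : 'M[C]_k) : opnorm (a *: M) = complex.Re `|a| * opnorm M.
Proof.
have [->|a0] := eqVneq a 0; first by rewrite scale0r opnorm0 normr0 mul0r.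
have a1 : 0 < complex.Re `|a| by rewrite -ltcR ReC normr_gt0.
apply/le_anti; rewrite opnormZ_le /= -ler_pdivlMl //.
rewrite -{1}(scalerK a0 M) (le_trans (opnormZ_le _ _)) //.
rewrite ler_wpM2r ?opnorm_ge0 // -lecR ReC normfV.
by rewrite fmorphV /= ReC.
Qed.

Lemma opnormN k (M : 'M[C]_k) : opnorm (- M) = opnorm M.
Proof. by rewrite -scaleN1r opnormZ normrN normr1 mul1r. Qed.

Lemma opnorm_isometry k (U : 'M[C]_k) : adj U *m U = 1%:M -> opnorm U <= 1.
Proof. by move=> UU; apply: opnorm_le => // v; rewrite l2norm_isometry // mul1r. Qed.

Lemma opnorm_diag k (d : 'rV[C]_k) c : 0 <= c ->
  (forall a, complex.Re `|d ord0 a| <= c) -> opnorm (diag_mx d) <= c.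
Proof.
move=> c0 dc; apply: opnorm_le => // v.
rewrite -(@ler_pXn2r _ 2) ?nnegrE ?mulr_ge0 ?l2norm_ge0 //
  exprMn -lecR [leRHS]rmorphM /=.
rewrite !l2norm_sqr mulr_sumr; apply: ler_sum => i _.
rewrite mul_diag_mx mxE normrM exprMn ler_wpM2r ?exprn_ge0 //.
have := dc i; rewrite -lecR ReC => dci.
have -> : (c ^+ 2)%:C%C = c%:C%C ^+ 2 :> C by rewrite rmorphXn.
by rewrite lerXn2r ?nnegrE ?ler0c //; case: (d _ _) => *; exact: sqrtr_ge0.
Qed.

Lemma opnorm_entry k (M : 'M[C]_k) a b : complex.Re `|M a b| <= opnorm M.
Proof.
have := opnormP M (delta_mx b ord0); rewrite l2norm_delta mulr1.
by apply: le_trans; have := l2norm_coord (M *m delta_mx b ord0) a; rewrite -colE mxE.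
Qed.

End OperatorNorm.

(** * Almost orthogonal matrices are close to a partition of a unitary basis *)

#[local] Opaque opnorm l2norm.

Section MatrixPerturbation.
Variable R : realType.
Local Notation C := R[i].
Local Notation toC := (real_complex R).

Lemma opnorm_sum k (I : Type) (r : seq I) (P : pred I) (F : I -> 'M[C]_k) :
  opnorm (\sum_(i <- r | P i) F i) <= \sum_(i <- r | P i) opnorm (F i).
Proof.
elim/big_ind2 : _ => [|u u' v v' h1 h2|//]; first by rewrite opnorm0.
exact: le_trans (opnormD _ _) (lerD h1 h2).
Qed.

Lemma opnormB k (M N : 'M[C]_k) : opnorm (M - N) = opnorm (N - M).
Proof. by rewrite -opnormN opprB. Qed.

Lemma opnormM_le k (M N : 'M[C]_k) a b :
  opnorm M <= a -> opnorm N <= b -> opnorm (M *m N) <= a * b.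
Proof.
by move=> Ma Nb; rewrite (le_trans (opnormM _ _)) // ler_pM ?opnorm_ge0.
Qed.

Lemma Re_norm_toC (x : R) : complex.Re `|toC x| = `|x|.
Proof. by rewrite normc_def /= expr0n addr0 sqrtr_sqr. Qed.

Lemma opnormZR k (x : R) (M : 'M[C]_k) : opnorm (toC x *: M) = `|x| * opnorm M.
Proof. by rewrite opnormZ Re_norm_toC. Qed.

Lemma unitary_spectral k (M : 'M[C]_k) : M \is normalmx ->
  exists (U : 'M[C]_k) (d : 'rV[C]_k),
    [/\ adj U *m U = 1%:M, U *m adj U = 1%:M & M = U *m diag_mx d *m adj U].
Proof.
move=> /orthomx_spectralP; set V := spectralmx M => e.
have VV : V *m adj V = 1%:M by apply/unitarymxP/spectral_unitarymx.
have VV' : adj V *m V = 1%:M by apply: mulmx1C.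
exists (adj V), (spectral_diag M); rewrite adjK; split; [exact: VV|exact: VV'|].
by rewrite {1}e (invmx_unitary (spectral_unitarymx M)).
Qed.

Lemma hermitian_spectral k (M : 'M[C]_k) : adj M = M ->
  exists (U : 'M[C]_k) (d : 'I_k -> R),
    [/\ adj U *m U = 1%:M, U *m adj U = 1%:M &
        M = U *m diag_mx (\row_a toC (d a)) *m adj U].
Proof.
move=> Mh; have Mn : M \is normalmx by apply/normalmxP; rewrite Mh.
have [U [d [UU UU' e]]] := unitary_spectral Mn.
exists U, (fun a => complex.Re (d ord0 a)); split; [exact: UU|exact: UU'|].
rewrite {1}e; congr (_ *m _ *m _); congr diag_mx; apply/rowP => a; rewrite mxE.
have : diag_mx d = adj (diag_mx d).
  have : adj U *m M *m U = adj (adj U *m M *m U) by rewrite !adjM adjK Mh mulmxA.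
  by rewrite e !mulmxA UU mul1mx -mulmxA UU mulmx1.
move=> /matrixP /(_ a a); rewrite !mxE eqxx !mulr1n => da.
by rewrite RRe_real //; apply/CrealP.
Qed.

(** The projections onto the blocks of the labelling [d] of the basis [U]. *)
Definition block_proj (W : finType) k (U : 'M[C]_k) (d : 'I_k -> W) (w : W) : 'M[C]_k :=
  U *m diag_mx (\row_a (d a == w)%:R) *m adj U.

Section BlockProjections.
Variables (W : finType) (k : nat) (U : 'M[C]_k) (d : 'I_k -> W).
Hypothesis UU : adj U *m U = 1%:M.
Hypothesis UU' : U *m adj U = 1%:M.
Local Notation P := (block_proj U d).

Lemma opnorm_conj M : opnorm (U *m M *m adj U) <= opnorm M.
Proof.
have h : opnorm (adj U) <= 1 by apply: opnorm_isometry; rewrite adjK.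
have := opnormM_le (opnormM_le (opnorm_isometry UU) (lexx (opnorm M))) h.
by rewrite mul1r mulr1.
Qed.

Lemma opnorm_conjV M : opnorm (adj U *m M *m U) <= opnorm M.
Proof.
have h : opnorm (adj U) <= 1 by apply: opnorm_isometry; rewrite adjK.
have := opnormM_le (opnormM_le h (lexx (opnorm M))) (opnorm_isometry UU).
by rewrite mul1r mulr1.
Qed.

Lemma opnorm_block_proj w : opnorm (P w) <= 1.
Proof.
apply: le_trans (opnorm_conj _) _; apply: opnorm_diag => // a; rewrite mxE.
by case: eqP => _; rewrite ?normr1 ?normr0.
Qed.

Lemma conj_diagM (a b : 'rV[C]_k) :
  (U *m diag_mx a *m adj U) *m (U *m diag_mx b *m adj U)
  = U *m diag_mx (\row_i (a ord0 i * b ord0 i)) *m adj U.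
Proof.
rewrite !mulmxA -(mulmxA _ (adj U) U) UU mulmx1 -(mulmxA U) mulmx_diag.
by congr (_ *m diag_mx _ *m _); apply/rowP => i; rewrite !mxE.
Qed.

Lemma block_projM w w' : P w *m P w' = (w == w')%:R *: P w.
Proof.
rewrite conj_diagM scalemxAl scalemxAr; congr (_ *m _ *m _).
rewrite -linearZ /=; congr diag_mx; apply/rowP => a; rewrite !mxE -natrM mulnb.
have [dw|//] := eqVneq (d a) w; last by rewrite mulr0.
by rewrite dw mulr1.
Qed.

Lemma sum_block_proj : \sum_w P w = 1%:M.
Proof.
rewrite /block_proj -mulmx_suml -mulmx_sumr -linear_sum /=.
have -> : \sum_w (\row_a (d a == w)%:R : 'rV[C]_k) = const_mx 1.
  apply/rowP => a; rewrite summxE (bigD1 (d a)) //= big1 => [|w wd].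
    by rewrite !mxE eqxx addr0.
  by rewrite mxE eq_sym (negbTE wd).
by rewrite diag_const_mx mulmx1.
Qed.

End BlockProjections.

(** Why near-projections round to projections: let [H] be the Hermitian part of
    [\sum_w w G_w], labels being read as integers.  On a unit eigenvector of
    [H] some [G_w] is not small, which forces the eigenvalue to be close to
    that label [w]; rounding the eigenvalues to labels gives [d], and two
    labels at distance at least 1 are separated by commuting with [H]. *)
Lemma almost_partition_of_unity (W : finType) : exists2 K : R, 0 < K &
  forall k (G : W -> 'M[C]_k) (e : R), 0 <= e -> e <= 1 / 4 ->
  (forall w, opnorm (G w) <= 2) ->
  (forall w w', opnorm (G w *m G w' - (w == w')%:R *: G w) <= e) ->
  (forall w, opnorm (adj (G w) - G w) <= e) ->
  opnorm (\sum_w G w - 1%:M) <= e ->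
  exists (U : 'M[C]_k) (d : 'I_k -> W),
    [/\ adj U *m U = 1%:M, U *m adj U = 1%:M &
        forall w, opnorm (G w - block_proj U d w) <= K * e].
Proof.
have [L LE] : exists L : R, L = #|W|%:R by eexists.
have L0 : 0 <= L by rewrite LE ler0n.
pose kappa : R := 3 * L ^+ 2.
exists (1 + 2 * (L * ((4 * L + 1) * kappa))).
  by rewrite ltr_pwDl // !mulr_ge0 ?addr_ge0 ?mulr_ge0 ?sqr_ge0.
move=> k G e e0 e4 G2 GG Gadj Gsum.
have [v [v0 vL v_sep]] : exists v : W -> R,
    [/\ forall w, 0 <= v w, forall w, v w <= L &
        forall w w', w != w' -> 1 <= `|v w - v w'|].
  exists (fun w => (enum_rank w)%:R); split=> [w|w|w w' ww'] //.
    by rewrite LE ler_nat ltnW.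
  have : (enum_rank w : nat) != enum_rank w'.
    by apply: contra_neq ww' => /ord_inj /enum_rank_inj.
  rewrite neq_ltn => /orP[] h.
    have : (enum_rank w).+1%:R <= (enum_rank w')%:R :> R by rewrite ler_nat.
    by rewrite -natr1 distrC => h1; rewrite ger0_norm; lra.
  have : (enum_rank w').+1%:R <= (enum_rank w)%:R :> R by rewrite ler_nat.
  by rewrite -natr1 => h1; rewrite ger0_norm; lra.
have sumL (F : W -> R) c : (forall w, F w <= c) -> \sum_w F w <= L * c.
  move=> Fc; apply: le_trans (ler_sum _ (fun w _ => Fc w)) _.
  by rewrite sumr_const LE mulr_natl.
pose h := \sum_w toC (v w) *: G w.
pose H := toC (1 / 2) *: (h + adj h).
have Hh : adj H = H.
  rewrite /H linearZ /= map_mxZ; congr (_ *: _); last by rewrite adjD adjK addrC.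
  by apply/CrealP/complex_realP; exists (1 / 2).
have Hnear : opnorm (H - h) <= L ^+ 2 * e.
  have -> : H - h = toC (1 / 2) *: (adj h - h).
    rewrite /H scalerDr scalerBr addrAC addrC; congr (_ + _).
    rewrite -[X in _ - X]scale1r -scalerBl -scaleNr; congr (_ *: _).
    by apply/eqP; rewrite eq_complex /=; apply/andP; split; apply/eqP; lra.
  rewrite opnormZR ger0_norm; last by lra.
  have hh : opnorm (adj h - h) <= L * (L * e).
    have -> : adj h - h = \sum_w toC (v w) *: (adj (G w) - G w).
      rewrite /h linear_sum map_mx_sum -sumrB; apply: eq_bigr => w _.
      rewrite linearZ /= map_mxZ scalerBr; congr (_ *: _ - _).
      by apply/CrealP/complex_realP; exists (v w).
    apply: le_trans (opnorm_sum _ _ _) _; apply: sumL => w.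
    rewrite opnormZR (ger0_norm (v0 w));
      exact: ler_pM (v0 w) (opnorm_ge0 _) (vL w) (Gadj w).
  move: (opnorm _) hh (opnorm_ge0 (adj h - h)) => t tL t0.
  by clear -tL t0; rewrite expr2 -mulrA; lra.
have GH w : opnorm (G w *m H - toC (v w) *: G w) <= kappa * e.
  have -> : G w *m H - toC (v w) *: G w = G w *m (H - h)
      + \sum_w' toC (v w') *: (G w *m G w' - (w == w')%:R *: G w).
    have -> : \sum_w' toC (v w') *: (G w *m G w' - (w == w')%:R *: G w)
        = G w *m h - toC (v w) *: G w.
      under eq_bigr do rewrite scalerBr.
      rewrite sumrB mulmx_sumr; congr (_ - _).
        by apply: eq_bigr => w' _; rewrite -scalemxAr.
      rewrite (bigD1 w) //= big1 => [|w' ww']; first by rewrite eqxx scale1r addr0.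
      by rewrite eq_sym (negbTE ww') scale0r scaler0.
    by rewrite mulmxBr addrA subrK.
  have h1 : opnorm (G w *m (H - h)) <= 2 * (L ^+ 2 * e) by apply: opnormM_le.
  have h2 : opnorm (\sum_w' toC (v w') *: (G w *m G w' - (w == w')%:R *: G w))
    <= L * (L * e).
    apply: le_trans (opnorm_sum _ _ _) _; apply: sumL => w'.
    rewrite opnormZR (ger0_norm (v0 w'));
      exact: ler_pM (v0 w') (opnorm_ge0 _) (vL w') (GG w w').
  apply: le_trans (opnormD _ _) _; apply: le_trans (lerD h1 h2) _.
  by clear; rewrite /kappa expr2; lra.
have [U [l [UU UU' HE]]] := hermitian_spectral Hh.
(* By [GH], [(l a - v w) *: (G w *m u)] is small for every eigenvector [u] of
   eigenvalue [l a], while some [G w *m u] is not small. *)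
have HU a : H *m col a U = toC (l a) *: col a U.
  rewrite HE colE !mulmxA -(mulmxA _ (adj U) U) UU mulmx1 -!mulmxA scalemxAr.
  congr (_ *m _); apply/colP => b; rewrite mul_diag_mx !mxE.
  by case: eqP => [->|_]; rewrite ?mulr0.
have /choice[d dP] : forall a : 'I_k, exists w : W, `|l a - v w| <= 2 * L * (kappa * e).
  move=> a.
  pose u := col a U.
  have u1 : l2norm u = 1 by rewrite /u colE l2norm_isometry // l2norm_delta.
  have Glu w : `|l a - v w| * l2norm (G w *m u) <= kappa * e.
    rewrite -Re_norm_toC -l2normZ.
    have -> : toC (l a - v w) *: (G w *m u) = (G w *m H - toC (v w) *: G w) *m u.
      by rewrite mulmxBl -mulmxA HU -scalemxAl -scalemxAr rmorphB scalerBl.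
    by have := opnormP (G w *m H - toC (v w) *: G w) u;
      rewrite u1 mulr1 => /le_trans; apply.
  have [w wP] : exists w, 1 / 2 <= L * l2norm (G w *m u).
    apply: contrapT => /forallNP small.
    have h1 : \sum_w l2norm (G w *m u) <= L * (2 * L)^-1.
      apply: sumL => w; have /negP := small w; rewrite -ltNge => /ltW Gw.
      have L1 : 0 < L by rewrite LE ltr0n; apply/card_gt0P; exists w.
      rewrite -(ler_pM2l L1); apply: le_trans Gw _.
      by rewrite invfM mulrCA mulfV ?gt_eqF // mulr1 mul1r.
    have h2 : L * (2 * L)^-1 <= 1 / 2.
      have [->|L1] := eqVneq L 0; first by rewrite mul0r; clear; lra.
      by rewrite invfM mulrCA mulfV // mulr1 mul1r.
    have h3 : 1 <= l2norm (\sum_w G w *m u) + e.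
      rewrite -u1 -[X in l2norm X <= _](subKr (\sum_w G w *m u)).
      apply: le_trans (l2normD _ _) _; rewrite l2normN lerD2l.
      rewrite -[X in _ - X]mul1mx -mulmx_suml -mulmxBl.
      by rewrite (le_trans (opnormP _ _)) // u1 mulr1.
    have h4 := l2norm_sum (index_enum W) predT (fun w => G w *m u).
    have := le_trans h3 (lerD (le_trans h4 (le_trans h1 h2)) e4).
    by clear; lra.
  exists w; have := ler_wpM2l (normr_ge0 (l a - v w)) wP.
  have := ler_wpM2l L0 (Glu w); move: (kappa * e) (l2norm _) `|_| => q t s.
  by clear; lra.
exists U, d; split => //.
pose P := block_proj U d.
pose H' := U *m diag_mx (\row_a toC (v (d a))) *m adj U.
have HH' : opnorm (H - H') <= 2 * L * (kappa * e).
  have -> : H - H' = U *m diag_mx (\row_a toC (l a - v (d a))) *m adj U.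
    rewrite HE -mulmxBl -mulmxBr -linearB /=; congr (_ *m diag_mx _ *m _).
    by apply/rowP => a; rewrite !mxE rmorphB.
  apply: le_trans (opnorm_conj UU UU' _) _; apply: opnorm_diag => [|a].
    by rewrite !mulr_ge0 // sqr_ge0.
  by rewrite mxE Re_norm_toC.
have H'P w : H' *m P w = toC (v w) *: P w.
  rewrite conj_diagM // scalemxAl scalemxAr; congr (_ *m _ *m _).
  rewrite -linearZ /=; congr diag_mx; apply/rowP => a; rewrite !mxE.
  by have [->|] := eqVneq (d a) w; rewrite ?mulr0.
have GH' w : opnorm (G w *m H' - toC (v w) *: G w) <= (4 * L + 1) * kappa * e.
  have -> : G w *m H' - toC (v w) *:
    G w = (G w *m H - toC (v w) *: G w) - G w *m (H - H').
    by rewrite mulmxBr opprB [RHS]addrC addrA subrK.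
  apply: le_trans (opnormD _ _) _; rewrite opnormN.
  apply: le_trans (lerD (GH w) (opnormM_le (G2 w) HH')) _.
  by clear; lra.
have off w w' : w != w' -> opnorm (G w *m P w') <= (4 * L + 1) * kappa * e.
  move=> /v_sep; rewrite distrC => sep.
  have : opnorm (toC (v w' - v w) *: (G w *m P w')) <= (4 * L + 1) * kappa * e.
    have -> : toC (v w' - v w) *: (G w *m P w') = (G w *m H' - toC (v w) *:
      G w) *m P w'.
      by rewrite mulmxBl -mulmxA H'P -scalemxAl -scalemxAr rmorphB scalerBl.
    by rewrite -[leRHS]mulr1; apply: opnormM_le (GH' w) (opnorm_block_proj d UU UU' w').
  rewrite opnormZR; apply: le_trans.
  by rewrite ler_peMl ?opnorm_ge0.
(* The diagonal terms follow from the off-diagonal ones, since both families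
   [G] and [P] sum to 1. *)
have q0 : 0 <= (4 * L + 1) * kappa * e.
  by rewrite !mulr_ge0 ?addr_ge0 ?mulr_ge0 ?sqr_ge0.
move=> w; set q := (4 * L + 1) * kappa * e in q0 off *.
have GGP : opnorm (G w - G w *m P w) <= L * q.
  have -> : G w - G w *m P w = \sum_w' (if w' == w then 0 else G w *m P w').
    rewrite -{1}[G w]mulmx1 -(sum_block_proj d UU') mulmx_sumr (bigD1 w) //= addrC
      addrK.
    rewrite [RHS](bigD1 w) //= eqxx add0r; apply: eq_bigr => w' /negbTE -> //.
  apply: le_trans (opnorm_sum _ _ _) _; apply: sumL => w'.
  by case: (eqVneq w' w) => [_|ww']; rewrite ?opnorm0 // off // eq_sym.
have PGP : opnorm (P w - G w *m P w) <= e + L * q.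
  have -> : P w - G w *m P w = - ((\sum_w' G w' - 1%:M) *m P w)
      + \sum_w' (if w' == w then 0 else G w' *m P w).
    rewrite mulmxBl mul1mx opprB mulmx_suml (bigD1 w) //=.
    rewrite [X in _ = _ + X](bigD1 w) //= eqxx add0r.
    rewrite [X in _ = _ + X](_ : _ = \sum_(i | i != w) G i *m P w).
      by rewrite opprD addrA subrK.
    by apply: eq_bigr => w' /negbTE ->.
  apply: le_trans (opnormD _ _) _; apply: lerD.
    rewrite opnormN -[leRHS]mulr1; apply: opnormM_le => //.
    exact: opnorm_block_proj.
  apply: le_trans (opnorm_sum _ _ _) _; apply: sumL => w'.
  by case: (eqVneq w' w) => [_|ww']; rewrite ?opnorm0 // off.
have -> : G w - block_proj U d w = (G w - G w *m P w) - (P w - G w *m P w).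
  by rewrite opprB addrA subrK.
apply: le_trans (opnormD _ _) _; rewrite opnormN.
by apply: le_trans (lerD GGP PGP) _; rewrite /q; clear; lra.
Qed.


End MatrixPerturbation.

(** * Block sizes and block compressions *)

Section BlockModels.
Variable R : realType.
Local Notation C := R[i].
Local Notation toC := (real_complex R).

(** Almost isometric copies of the range of [P_w] under the [s_u], almost
    orthogonal to each other, are linearly independent: in a linear dependency
    the largest term would be small compared to itself. *)
Lemma block_size_le (W I : finType) k (U : 'M[C]_k) (d : 'I_k -> W) (w : W)
    (r s : I -> 'M[C]_k) (e : R) :
  adj U *m U = 1%:M -> U *m adj U = 1%:M -> e * #|I|%:R < 1 ->
  (forall u u', opnorm (block_proj U d w *m r u *m s u' *m block_proj U d w
                 - (u == u')%:R *: block_proj U d w) <= e) ->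
  (#|I| * #|[pred a | d a == w]| <= k)%N.
Proof.
move=> UU UU' eI rs; set P := block_proj U d w in rs *.
rewrite -cardX; set D := [predX I & _]; rewrite leqNgt; apply/negP => kD.
pose ix (t : 'I_#|D|) : I * 'I_k := enum_val t.
have ixD t : d (ix t).2 = w.
  by have := enum_valP t; rewrite -/(ix t); case: (ix t) => u a;
    rewrite !inE /= => /eqP.
pose B : 'M[C]_(#|D|, k) := \matrix_(t, b) (s (ix t).1 *m col (ix t).2 U) b ord0.
have [v v0 vB] : exists2 v : 'rV[C]_#|D|, v != 0 & v *m B = 0.
  have : kermx B != 0.
    by rewrite -mxrank_eq0 mxrank_ker subn_eq0 -ltnNge (leq_ltn_trans (rank_leq_col B)).
  by move=> /rowV0Pn[v /sub_kermxP vB v0]; exists v.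
pose xi u := \sum_(t | (ix t).1 == u) v ord0 t *: col (ix t).2 U.
have Pxi u : P *m xi u = xi u.
  rewrite mulmx_sumr; apply: eq_bigr => t _; rewrite -scalemxAr; congr (_ *: _).
  rewrite colE /P /block_proj !mulmxA -(mulmxA _ (adj U) U) UU mulmx1 -mulmxA.
  congr (_ *m _); apply/colP => b; rewrite mul_diag_mx !mxE.
  by have [->|_] := eqVneq b (ix t).2; rewrite ?mulr0 // ixD eqxx mul1r.
have sxi : \sum_u s u *m xi u = 0.
  apply/colP => b; have /rowP/(_ b) := vB; rewrite !mxE => <-.
  rewrite summxE (partition_big (fun t => (ix t).1) predT) //=.
  apply: eq_bigr => u _; rewrite mulmx_sumr summxE; apply: eq_bigr => t /eqP tu.
  by rewrite -scalemxAr !mxE tu; congr (_ * _); apply: eq_bigr => j _; rewrite !mxE.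
have [u0 u0_max xi_u0] : exists2 u0, forall u, l2norm (xi u) <= l2norm (xi u0)
    & 0 < l2norm (xi u0).
  have [t0 t00] : exists t, v ord0 t != 0.
    by apply/existsP; apply: contra_neqT v0 => /existsPn v0; apply/rowP => t;
       rewrite mxE; apply/eqP; have := v0 t; rewrite negbK.
  have xi_t0 : 0 < l2norm (xi (ix t0).1).
    rewrite lt_def l2norm_ge0 andbT;
      apply: contra_neq t00 => /l2norm_eq0 /(congr1 (mulmx (adj U))).
    rewrite mulmx0 /xi mulmx_sumr => /colP /(_ (ix t0).2).
    rewrite summxE (bigD1 t0) //= big1 => [|t /andP[/eqP t1 tt0]].
      by rewrite addr0 colE -scalemxAr mulmxA UU mul1mx !mxE !eqxx mulr1.
    rewrite colE -scalemxAr mulmxA UU mul1mx !mxE.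
    have [t2|_] := eqVneq (ix t0).2 (ix t).2; last by rewrite mulr0.
    by case/eqP: tt0; apply: enum_val_inj; move: t1 t2; rewrite /ix;
      case: (enum_val t) (enum_val t0) => ? ? [? ?] /= -> ->.
  have [u0 _ u0P] := @arg_maxP _ _ _ (ix t0).1 predT (fun u => l2norm (xi u)) isT.
  exists u0 => [u|]; first exact: u0P.
  exact: lt_le_trans xi_t0 (u0P _ isT).
have e0 : 0 <= e by apply: le_trans (opnorm_ge0 _) (rs u0 u0).
have xiE : xi u0 = - \sum_u (P *m r u0 *m s u *m P - (u0 == u)%:R *: P) *m xi u.
  under eq_bigr => u _.
    rewrite mulmxBl -(mulmxA _ P (xi u)) Pxi -scalemxAl Pxi -mulmxA; over.
  rewrite sumrB -mulmx_sumr sxi mulmx0 sub0r opprK (bigD1 u0) //= big1 => [|u uu0].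
    by rewrite eqxx scale1r addr0.
  by rewrite eq_sym (negbTE uu0) scale0r.
have : l2norm (xi u0) <= e * #|I|%:R * l2norm (xi u0).
  rewrite {1}xiE l2normN; apply: le_trans (l2norm_sum _ _ _) _.
  rewrite mulrAC mulr_natr -sumr_const; apply: ler_sum => u _.
  apply: le_trans (opnormP _ _) _; apply: ler_pM; rewrite ?opnorm_ge0 ?l2norm_ge0 //.
by rewrite leNgt => /negP; apply; rewrite -[ltRHS]mul1r ltr_pM2r.
Qed.

Lemma commutator_swap (V : zmodType) (a b c e : V) :
  e - b = (a - b) - (c - e) - (a - c).
Proof. by rewrite opprB opprB !addrA subrK addrC !addrA addNr add0r addrC. Qed.

(** The witness is the pinching of [X] by the block projections [P w]:
    [X - \sum_w P w X P w] is the sum of the [(X P w - P w X) P w]. *)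
Lemma block_compression (W : finType) k (U : 'M[C]_k) (d : 'I_k -> W)
    (G : W -> 'M[C]_k) (X : 'M[C]_k) (e1 e2 c : R) :
  adj U *m U = 1%:M -> U *m adj U = 1%:M -> opnorm X <= c -> 0 <= c ->
  (forall w, opnorm (G w - block_proj U d w) <= e1) ->
  (forall w, opnorm (G w *m X - X *m G w) <= e2) ->
  exists Y : 'M[C]_k, [/\ forall a b, d a != d b -> Y a b = 0,
    opnorm (X - U *m Y *m adj U) <= #|W|%:R * (2 * c * e1 + e2) &
    opnorm Y <= c + #|W|%:R * (2 * c * e1 + e2)].
Proof.
move=> UU UU' Xc c0 GP GX.
pose P := block_proj U d.
pose Y :=
  \sum_w diag_mx (\row_a (d a == w)%:R) *m (adj U *m X *m U) *m diag_mx
  (\row_a (d a == w)%:R).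
have UYU : U *m Y *m adj U = \sum_w P w *m X *m P w.
  rewrite mulmx_sumr mulmx_suml; apply: eq_bigr => w _.
  rewrite /P /block_proj; move: (diag_mx _) (adj U) => D V.
  by rewrite !mulmxA.
have near : opnorm (X - U *m Y *m adj U) <= #|W|%:R * (2 * c * e1 + e2).
  have -> : X - U *m Y *m adj U = \sum_w (X *m P w - P w *m X) *m P w.
    rewrite UYU; under [RHS]eq_bigr do rewrite mulmxBl -(mulmxA X) block_projM //
      eqxx scale1r.
    by rewrite sumrB -mulmx_sumr sum_block_proj // mulmx1.
  apply: le_trans (opnorm_sum _ _ _) _.
  rewrite mulr_natl -sumr_const; apply: ler_sum => w _.
  rewrite -[leRHS]mulr1; apply: opnormM_le; last exact: opnorm_block_proj.
  have -> : X *m P w - P w *m X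
    = (G w - P w) *m X - X *m (G w - P w) - (G w *m X - X *m G w).
    by rewrite mulmxBl mulmxBr -commutator_swap.
  have h1 := opnormM_le (GP w) Xc; have h2 := opnormM_le Xc (GP w).
  apply: le_trans (opnormD _ _) _; rewrite opnormN; apply: lerD (GX w).
  apply: le_trans (opnormD _ _) _; rewrite opnormN; apply: le_trans (lerD h1 h2) _.
  by clear; lra.
exists Y; split => //.
- move=> a b dab; rewrite /Y summxE big1 // => w _.
  rewrite mul_mx_diag mul_diag_mx !mxE.
  have [daw|] := eqVneq (d a) w; last by rewrite !mul0r.
  by rewrite -daw [d b == _]eq_sym (negbTE dab) mulr0.
- have -> : Y = adj U *m (X - (X - U *m Y *m adj U)) *m U.
    by rewrite subKr !mulmxA UU mul1mx -mulmxA UU mulmx1.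
  apply: le_trans (opnorm_conjV UU UU' _) _; apply: le_trans (opnormD _ _) _.
  by rewrite opnormN lerD.
Qed.

End BlockModels.

(** * A Lipschitz chart of the unitary group by Hermitian contractions *)

Section Cayley.
Variable R : realType.
Local Notation C := R[i].
Local Notation toC := (real_complex R).
Local Notation I := ((Complex 0 1) : C).

Definition resolvent k (H : 'M[C]_k) : 'M[C]_k := invmx (1%:M - I *: H).

(** The square of the Cayley transform [(1 + iH) / (1 - iH)].  On scalars this is
    [exp (4 i arctan h)], which covers the circle when [h] ranges over [-1, 1]:
    contractions suffice, whereas the Cayley transform itself is onto only in
    the limit. *)
Definition cayley_sqr k (H : 'M[C]_k) : 'M[C]_k :=
  (toC 2 *: resolvent H - 1%:M) *m (toC 2 *: resolvent H - 1%:M).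

Definition cayley_scalar (x : R) : C := toC 2 * (1 - I * toC x)^-1 - 1.

Lemma one_sub_i_neq0 (x : R) : 1 - I * toC x != 0.
Proof.
rewrite eq_complex /= negb_and; apply/orP; left.
by rewrite !mul0r mulr0 subrr subr0 oner_eq0.
Qed.

Lemma resolvent_diag k (U : 'M[C]_k) (h : 'I_k -> R) :
  adj U *m U = 1%:M -> U *m adj U = 1%:M ->
  let H := U *m diag_mx (\row_a toC (h a)) *m adj U in
  (1%:M - I *: H) \in unitmx /\
  resolvent H = U *m diag_mx (\row_a (1 - I * toC (h a))^-1) *m adj U.
Proof.
move=> UU UU' H; set Q := U *m diag_mx (\row_a (1 - _)^-1) *m adj U.
have QH : Q *m (1%:M - I *: H) = 1%:M.
  have -> : 1%:M - I *: H = U *m diag_mx (\row_a (1 - I * toC (h a))) *m adj U.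
    have -> : \row_a (1 - I * toC (h a)) = const_mx 1 - I *: \row_a toC (h a).
      by apply/rowP => a; rewrite !mxE.
    have -> : diag_mx (const_mx 1 - I *: \row_a toC (h a)) = 1%:M - I *:
      diag_mx (\row_a toC (h a)).
      by rewrite linearB linearZ /= diag_const_mx.
    by rewrite mulmxBr mulmxBl mulmx1 UU' -scalemxAr -scalemxAl.
  rewrite conj_diagM //; set D := \row_i _; have -> : D = const_mx 1.
    by apply/rowP => a; rewrite !mxE mulVf // one_sub_i_neq0.
  by rewrite diag_const_mx mulmx1.
have HU : (1%:M - I *: H) \in unitmx by have [_] := mulmx1_unit QH.
split => //; rewrite /resolvent.
by have := mulmxK HU Q; rewrite QH mul1mx.
Qed.

Lemma cayley_sqr_diag k (U : 'M[C]_k) (h : 'I_k -> R) :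
  adj U *m U = 1%:M -> U *m adj U = 1%:M ->
  cayley_sqr (U *m diag_mx (\row_a toC (h a)) *m adj U)
  = U *m diag_mx (\row_a (cayley_scalar (h a) * cayley_scalar (h a))) *m adj U.
Proof.
move=> UU UU'; rewrite /cayley_sqr; have [_ ->] := resolvent_diag h UU UU'.
set E := _ - _; have -> : E = U *m diag_mx (\row_a cayley_scalar (h a)) *m adj U.
  have -> : \row_a cayley_scalar (h a) = toC 2 *:
    \row_a (1 - I * toC (h a))^-1 - const_mx 1.
    by apply/rowP => a; rewrite !mxE.
  set D := \row_a _; have -> : diag_mx (toC 2 *: D - const_mx 1) = toC 2 *:
    diag_mx D - 1%:M.
    by rewrite linearB linearZ /= diag_const_mx.
  by rewrite mulmxBr mulmxBl mulmx1 UU' -scalemxAr -scalemxAl.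
rewrite conj_diagM //; congr (_ *m diag_mx _ *m _); apply/rowP => a.
by rewrite !mxE.
Qed.

Lemma normc_one_sub_i (x : R) : 1 <= complex.Re `|1 - I * toC x|.
Proof.
rewrite normc_def /= [X in Num.sqrt X](_ : _ = 1 + x ^+ 2); last by ring.
by rewrite -[leLHS]sqrtr1 ler_sqrt ?lerDl ?addr_ge0 ?sqr_ge0.
Qed.

Lemma resolvent_norm k (H : 'M[C]_k) : adj H = H ->
  (1%:M - I *: H) \in unitmx /\ opnorm (resolvent H) <= 1.
Proof.
move=> /hermitian_spectral[U [h [UU UU' ->]]].
have [HU ->] := resolvent_diag h UU UU'; split => //.
apply: le_trans (opnorm_conj UU UU' _) _; apply: opnorm_diag => // a; rewrite mxE.
rewrite -lecR ReC normfV -ReC; have := normc_one_sub_i (h a).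
move: (complex.Re _) => t t1; rewrite -fmorphV lecR invf_le1 //.
exact: lt_le_trans t1.
Qed.

Lemma resolvent_lipschitz k (H H' : 'M[C]_k) : adj H = H -> adj H' = H' ->
  opnorm (resolvent H - resolvent H') <= opnorm (H - H').
Proof.
move=> Hh Hh'; have [HU H1] := resolvent_norm Hh; have [HU' H1'] := resolvent_norm Hh'.
have -> : resolvent H - resolvent H' = resolvent H *m (I *: (H - H')) *m resolvent H'.
  have -> : I *: (H - H') = (1%:M - I *: H') - (1%:M - I *: H).
    by rewrite scalerBr opprB [RHS]addrC addrA subrK.
  by rewrite mulmxBr mulmxBl mulVmx // mul1mx -mulmxA mulmxV // mulmx1.
have := opnormM_le (opnormM_le H1 (lexx (opnorm (I *: (H - H'))))) H1'.
by rewrite mul1r mulr1 opnormZ normc_def /= expr0n expr1n add0r sqrtr1 mul1r.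
Qed.

Lemma mulmx_sqrB k (A B : 'M[C]_k) :
  A *m A - B *m B = A *m (A - B) + (A - B) *m B.
Proof. by rewrite mulmxBr mulmxBl addrA subrK. Qed.

(** By the resolvent identity: the resolvents [(1 - iH)^-1] of Hermitian matrices
    are contractions. *)
Lemma cayley_sqr_lipschitz k (H H' : 'M[C]_k) : adj H = H -> adj H' = H' ->
  opnorm (cayley_sqr H - cayley_sqr H') <= 12 * opnorm (H - H').
Proof.
move=> Hh Hh'.
have cay3 (H0 : 'M[C]_k) : adj H0 = H0 -> opnorm (toC 2 *: resolvent H0 - 1%:M) <= 3.
  move=> /resolvent_norm[_ r1]; apply: le_trans (opnormD _ _) _;
    rewrite opnormN opnormZR.
  have o1 : opnorm (1%:M : 'M[C]_k) <= 1 by apply: opnorm_isometry;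
    rewrite mulmx1 trmx1 map_mx1.
  rewrite ger0_norm; last by clear; lra.
  by move: (opnorm _) (opnorm _) r1 o1 => s t; clear; lra.
set A := toC 2 *: resolvent H - 1%:M; set B := toC 2 *: resolvent H' - 1%:M.
have -> : cayley_sqr H - cayley_sqr H' = A *m (A - B) + (A - B) *m B.
  exact: mulmx_sqrB.
have AB : opnorm (A - B) <= 2 * opnorm (H - H').
  have -> : A - B = toC 2 *: (resolvent H - resolvent H').
    by rewrite /A /B opprB addrA subrK scalerBr.
  rewrite opnormZR (ger0_norm (ler0n R 2)).
  by have := ler_wpM2l (ler0n R 2) (resolvent_lipschitz Hh Hh').
apply: le_trans (opnormD _ _) _.
apply: le_trans (lerD (opnormM_le (cay3 _ Hh) AB) (opnormM_le AB (cay3 _ Hh'))) _.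
by clear; lra.
Qed.

Lemma adj_conj_diag k (V : 'M[C]_k) (z : 'rV[C]_k) :
  adj (V *m diag_mx z *m adj V) = V *m diag_mx (map_mx Num.conj z) *m adj V.
Proof. by rewrite adjM adjM adjK mulmxA tr_diag_mx map_diag_mx. Qed.

(** The witness is the tangent of a quarter of the argument of [z], written
    through the square root [a + i b] of [z] with [0 <= a]. *)
Lemma cayley_scalar_onto (z : C) : z * z^* = 1 ->
  exists x : R, `|x| <= 1 /\ cayley_scalar x * cayley_scalar x = z.
Proof.
move=> zz.
have [a [b [a0 ab zE]]] : exists a b : R,
    [/\ 0 <= a, a ^+ 2 + b ^+ 2 = 1 & z = Complex a b * Complex a b].
  have [z1] : toC (complex.Re z ^+ 2 + complex.Im z ^+ 2) = toC 1.
    by rewrite add_Re2_Im2 normCK.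
  have := sqr_sqrtc z; case E : (sqrtc z) => [a b] ab.
  have ab1 : a ^+ 2 + b ^+ 2 = 1.
    have : (a ^+ 2 + b ^+ 2) ^+ 2 = 1 by rewrite -z1 -ab /=; ring.
    have := addr_ge0 (sqr_ge0 a) (sqr_ge0 b).
    by move: (a ^+ 2 + b ^+ 2) => t; clear; nra.
  have [a0|a0] := leP 0 a; first by exists a, b; rewrite -expr2.
  exists (- a), (- b); split; first by rewrite oppr_ge0 ltW.
    by rewrite !sqrrN.
  have -> : Complex (- a) (- b) = - Complex a b by [].
  by rewrite mulrNN -expr2.
have a1 : 0 < 1 + a by rewrite ltr_pwDl.
exists (b / (1 + a)); split.
  rewrite ler_norml ler_pdivlMr // ler_pdivrMr //; apply/andP.
  by clear -ab a0; split; nra.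
suff -> : cayley_scalar (b / (1 + a)) = Complex a b by rewrite zE.
have xb : b / (1 + a) * (1 + a) = b by rewrite mulfVK // gt_eqF.
move: (b / (1 + a)) xb => x xb.
have key : x ^+ 2 * (1 + a) + (1 + a) = 2.
  apply: (mulfI (lt0r_neq0 a1)); clear -xb ab.
  have : (x * (1 + a)) ^+ 2 = b ^+ 2 by rewrite xb.
  by lra.
have nz := one_sub_i_neq0 x.
apply/eqP; rewrite /cayley_scalar subr_eq -(inj_eq (mulIf nz)) mulfVK //.
rewrite eq_complex /=; apply/andP; rewrite -xb; split; apply/eqP; last by clear; ring.
by clear -key; lra.
Qed.

Lemma unitary_cayley_sqr k (U : 'M[C]_k) : adj U *m U = 1%:M -> U *m adj U = 1%:M ->
  exists H : 'M[C]_k, [/\ adj H = H, opnorm H <= 1 & cayley_sqr H = U].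
Proof.
move=> UU UU'; have Un : U \is normalmx by apply/normalmxP; rewrite UU UU'.
have [V [z [VV VV' UE]]] := unitary_spectral Un.
have zz a : z ord0 a * (z ord0 a)^* = 1.
  have : U *m adj U = 1%:M by [].
  rewrite {1 2}UE adj_conj_diag conj_diagM // => /(congr1 (fun M => adj V *m M *m V)).
  rewrite mulmx1 VV; set D := diag_mx _.
  have -> : adj V *m (V *m D *m adj V) *m V = D.
    by rewrite -(mulmxA V) (mulmxA (adj V) V) VV mul1mx -mulmxA VV mulmx1.
  by move=> /matrixP /(_ a a); rewrite !mxE eqxx !mulr1n.
have [h hP] : exists h : 'I_k -> R, forall a, `|h a| <= 1 /\
    cayley_scalar (h a) * cayley_scalar (h a) = z ord0 a.
  suff /choice[h hP] : forall a, exists x : R,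
    `|x| <= 1 /\ cayley_scalar x * cayley_scalar x = z ord0 a by exists h.
  by move=> a; exact: cayley_scalar_onto.
exists (V *m diag_mx (\row_a toC (h a)) *m adj V); split.
- rewrite adj_conj_diag; congr (_ *m _ *m _).
  congr diag_mx; apply/rowP => a; rewrite !mxE.
  by apply/CrealP/complex_realP; exists (h a).
- apply: le_trans (opnorm_conj VV VV' _) _; apply: opnorm_diag => // a.
  by rewrite mxE Re_norm_toC; have [] := hP a.
- rewrite cayley_sqr_diag // [RHS]UE; congr (_ *m diag_mx _ *m _).
  by apply/rowP => a; rewrite mxE; have [_ ->] := hP a.
Qed.

End Cayley.

(** * Covering numbers of balls in finite-dimensional real normed spaces *)

Section LatticeCounting.
Variables (R : realType) (T : finType) (nu : {ffun T -> R} -> R).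
Hypothesis nuD : forall x y, nu (x + y) <= nu x + nu y.
Hypothesis nuZ : forall a x, nu (a *: x) = `|a| * nu x.
Hypothesis nu_coord : exists c1 : R, forall (x : {ffun T -> R}) t, `|x t| <= c1 * nu x.

Let lat (z : {ffun T -> int}) : {ffun T -> R} := [ffun t => (z t)%:~R].

Lemma nu_ge0 x : 0 <= nu x.
Proof.
have h : nu 0 = 0 by rewrite -(scale0r x) nuZ normr0 mul0r.
have := nuD x ((-1) *: x).
rewrite nuZ normrN1 mul1r scaleN1r subrr h => hx; lra.
Qed.

Lemma nuN x : nu (- x) = nu x.
Proof. by rewrite -scaleN1r nuZ normrN1 mul1r. Qed.

Lemma nu_le_sup : exists2 c : R, 0 < c &
  forall (x : {ffun T -> R}) M, 0 <= M -> (forall t, `|x t| <= M) -> nu x <= c * M.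
Proof.
pose b t : {ffun T -> R} := [ffun s => (s == t)%:R].
exists (1 + \sum_t nu (b t)); first by rewrite ltr_wpDr // sumr_ge0 // => t _;
  exact: nu_ge0.
move=> x M M0 xM.
have -> : x = \sum_t x t *: b t.
  apply/ffunP => s; rewrite sum_ffunE (bigD1 s) //= big1 => [|t ts]; last first.
    by rewrite !ffunE eq_sym (negbTE ts) /= scaler0.
  by rewrite !ffunE eqxx addr0 /= -[LHS]mulr1.
have nu0 : nu 0 = 0 by rewrite -(scale0r x) nuZ normr0 mul0r.
apply: (@le_trans _ _ (\sum_t nu (x t *: b t))).
  elim/big_ind2 : _ => [|u u' v v' h1 h2|//]; first by rewrite nu0.
  exact: le_trans (nuD _ _) (lerD h1 h2).
rewrite mulrDl mul1r ler_wpDl // mulr_suml ler_sum // => t _.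
by rewrite nuZ mulrC ler_wpM2l ?nu_ge0.
Qed.

Let lat_add z1 z2 : lat (z1 + z2) = lat z1 + lat z2.
Proof. by apply/ffunP => t; rewrite !ffunE intrD. Qed.

(** The number of its lattice points plays the role of the volume of a ball. *)
Lemma lattice_ball (r : R) : 0 <= r ->
  exists s : seq {ffun T -> int},
    [/\ uniq s, (0 < size s)%N & forall z, (z \in s) = (nu (lat z) <= r)].
Proof.
move=> r0; have [c1 c1P] := nu_coord.
have [K KP] : exists K : nat, forall z, nu (lat z) <= r ->
    forall t, (`|z t| <= K)%N.
  exists (Num.trunc (`|c1| * r)).+1 => z zr t.
  suff : (`|z t|%N%:R : R) < (Num.trunc (`|c1| * r)).+1%:R by rewrite ltr_nat => /ltnW.
  apply: le_lt_trans (truncnS_gt _).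
  have := c1P (lat z) t; rewrite ffunE natr_absz intr_norm => /le_trans; apply.
  apply: le_trans (ler_wpM2r (nu_ge0 _) (ler_norm c1)) _.
  exact: ler_wpM2l.
pose f (g : {ffun T -> 'I_(2 * K).+1}) : {ffun T -> int} :=
  [ffun t => (g t : nat)%:Z - K%:Z].
have f_inj : injective f.
  move=> g h /ffunP e; apply/ffunP => t; apply: val_inj.
  by have := e t; rewrite !ffunE => /addIr [].
exists [seq z <- map f (enum {: {ffun T -> 'I_(2 * K).+1}}) | nu (lat z) <= r].
have mem z :
  (z \in [seq z <- map f (enum {: {ffun T -> 'I_(2 * K).+1}}) | nu (lat z) <= r])
  = (nu (lat z) <= r).
  rewrite mem_filter; case: (boolP (_ <= r)) => //= zr.
  apply/mapP; exists [ffun t => inord (absz (z t + K%:Z))]; first by rewrite mem_enum.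
  apply/ffunP => t; rewrite !ffunE.
  move: (z t) (KP _ zr t) => u; rewrite -lez_nat abszE => uK.
  have [h1 h2] : - K%:Z <= u /\ u <= K%:Z by apply/andP; rewrite -ler_norml.
  by rewrite inordK; lia.
split => //; first by rewrite filter_uniq // map_inj_uniq // enum_uniq.
have : 0 \in [seq z <- map f (enum {: {ffun T -> 'I_(2 * K).+1}}) | nu (lat z) <= r].
  rewrite mem; have -> : lat 0 = 0 by apply/ffunP => t; rewrite !ffunE.
  by rewrite -(scale0r 0) nuZ normr0 mul0r.
by case: [seq _ <- _ | _].
Qed.


(** The volume argument, with lattice points in place of Lebesgue measure.  On
    a fine enough grid the points [y i] are rounded to lattice points whose
    translates of a small ball [b] are disjoint and lie in a ball about [4 / d]
    times larger.  Euclidean division by [m] maps that large ball into [b], with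
    fibres of at most [m ^ #|T|] points; so the number of translates is at most
    [m ^ #|T|].  Counting is exact for every grid, and no limit is taken. *)
Lemma separated_family_size (d : R) (m p : nat) (y : 'I_p -> {ffun T -> R}) :
  0 < d <= 1 -> 6 / d <= m%:R -> (forall i, nu (y i) <= 1) ->
  (forall i j, i != j -> d < nu (y i - y j)) -> (p <= m ^ #|T|)%N.
Proof.
move=> /andP[d0 d1] dm y1 ysep.
have m0 : 0 < m%:R :> R by apply: lt_le_trans dm; rewrite divr_gt0.
have [c c0 cP] := nu_le_sup.
(* The grid spacing [1 / M] makes a rounding error, at most [c] after scaling
   by [M], equal to an eighth of [M * d]. *)
pose M : R := 8 * c / d.
have M0 : 0 < M by rewrite divr_gt0 ?mulr_gt0.
have cM : c = M * d / 8 by rewrite /M; field; rewrite gt_eqF.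
pose z i : {ffun T -> int} := [ffun t => Num.floor (M * y i t)].
have zy i : nu (M *: y i - lat (z i)) <= c.
  rewrite -[leRHS]mulr1; apply: cP => // t; rewrite !ffunE /=.
  have := floor_itv (M * y i t); rewrite intrD /= => /andP[h1 h2].
  change (`|M * y i t - (Num.floor (M * y i t))%:~R| <= 1).
  rewrite ler_norml; apply/andP; split; lra.
(* Rounded centres stay [M * d * 3 / 4] apart, twice this radius. *)
pose r : R := M * d * 3 / 8.
have Md : M * d <= M by rewrite ger_pMr.
have Md0 : 0 < M * d by rewrite mulr_gt0.
have r0 : 0 <= r by rewrite /r; lra.
have [b [b_uniq b_gt0 bP]] := lattice_ball r0.
have translates_disjoint : {in [seq (i, w) | i <- enum 'I_p, w <- b] &,
    injective (fun iw : 'I_p * {ffun T -> int} => z iw.1 + iw.2)}.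
  move=> [i w] [j w'] /allpairsP[[i1 w1] [_ /= w1b [-> ->]]]
    /allpairsP[[i2 w2] [_ /= w2b [-> ->]]] e.
  case: (eqVneq i1 i2) e => [<- /addrI -> //|ij e]; exfalso.
  have zz : nu (lat (z i1) - lat (z i2)) <= 2 * r.
    have -> : lat (z i1) - lat (z i2) = lat w2 - lat w1.
      by apply/eqP; rewrite subr_eq addrAC eq_sym subr_eq -!lat_add addrC -e addrC.
    apply: le_trans (nuD _ _) _; rewrite nuN.
    by move: w1b w2b; rewrite !bP; lra.
  have := ysep _ _ ij.
  have : nu (M *: (y i1 - y i2)) <= c + 2 * r + c.
    have -> : M *: (y i1 - y i2) = (M *: y i1 - lat (z i1)) + (lat (z i1) - lat (z i2))
       + - (M *: y i2 - lat (z i2)).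
      by rewrite scalerBr subrKA opprB addrA subrK.
    apply: le_trans (nuD _ _) _; rewrite nuN; apply: lerD (zy _).
    by apply: le_trans (nuD _ _) _; apply: lerD (zy _) zz.
  rewrite nuZ gtr0_norm // => h1; rewrite -(ltr_pM2l M0) => h2.
  by rewrite /r cM in h1; lra.
case: m dm m0 => [|m] dm m0; first by rewrite ltxx in m0.
have [quo [rem quo_rem]] : exists (quo : {ffun T -> int} -> {ffun T -> int})
    (rem : {ffun T -> int} -> {ffun T -> 'I_m.+1}),
    forall (v : {ffun T -> int}) t, v t = quo v t * m.+1%:Z + (rem v t : nat)%:Z.
  exists (fun v => [ffun t => divz (v t) m.+1]).
  exists (fun v => [ffun t => inord (absz (modz (v t) m.+1))]) => v t.
  have r_ge0 := modz_ge0 (v t) (isT : m.+1%:Z != 0).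
  have := ltz_mod (v t) (isT : m.+1%:Z != 0).
  rewrite !ffunE -{1}(gez0_abs r_ge0) ltz_nat absz_nat => r_lt.
  by rewrite inordK // gez0_abs //; exact: divz_eq.
have quo_rem_inj : injective (fun v => (quo v, rem v)).
  by move=> v w [e1 e2]; apply/ffunP => t; rewrite quo_rem (quo_rem w) e1 e2.
have quo_ball (v : {ffun T -> int}) : nu (lat v) <= M * 3 / 2 -> quo v \in b.
  move=> hv; rewrite bP -(ler_pM2l m0).
  have e : m.+1%:R *: lat (quo v) = lat v - [ffun t => (rem v t : nat)%:R].
    apply/ffunP => t; rewrite !ffunE /= (quo_rem v) intrD intrM.
    by rewrite addrK mulrC.
  rewrite -[X in X * nu _ <= _](gtr0_norm m0) -nuZ e.
  apply: le_trans (nuD _ _) _; rewrite nuN.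
  have : nu [ffun t => (rem v t : nat)%:R] <= c * m.+1%:R.
    apply: cP => [|t]; first exact: ltW.
    by rewrite ffunE normr_nat ler_nat ltnW.
  have : 6 * M <= M * d * m.+1%:R.
    move: dm; rewrite ler_pdivrMr // => dm.
    by have := ler_wpM2l (ltW M0) dm; lra.
  rewrite /r cM; lra.
have : (size [seq (quo (z iw.1 + iw.2)%R, rem (z iw.1 + iw.2)%R) |
    iw : 'I_p * {ffun T -> int} <- [seq (i, w) | i <- enum 'I_p, w <- b]]
   <= size [seq (q, u) | q <- b, u <- enum {: {ffun T -> 'I_m.+1}}])%N.
  apply: uniq_leq_size.
    rewrite map_inj_in_uniq; last first.
      by move=> iw iw' h1 h2 /quo_rem_inj; exact: translates_disjoint.
    by apply: allpairs_uniq => //; [exact: enum_uniq|move=> [? ?] [? ?]].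
  move=> qu /mapP[[i w] /allpairsP[[i' w'] [_ /= wb [-> ->]]] ->] /=.
  apply/allpairsP; exists (quo (z i' + w'), rem (z i' + w')) => /=; split => //;
    last by rewrite mem_enum.
  apply: quo_ball; rewrite lat_add; apply: le_trans (nuD _ _) _.
  move: wb; rewrite bP => wb.
  have : nu (lat (z i')) <= M + c.
    have -> : lat (z i') = M *: y i' - (M *: y i' - lat (z i'))
      by rewrite opprB addrC subrK.
    apply: le_trans (nuD _ _) _; rewrite nuN; apply: lerD (zy _).
    by rewrite nuZ gtr0_norm // ler_piMr // ltW.
  rewrite cM /r in wb *; lra.
rewrite size_map !size_allpairs -!cardE card_ord card_ffun card_ord mulnC.
by rewrite leq_pmul2l.
Qed.

(** A maximal separated subset of [S] is a net of [S]; its points lie in [S],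
    so that they inherit any constraint defining [S]. *)
Lemma internal_net (d : R) (m : nat) (S : set {ffun T -> R}) :
  0 < d <= 1 -> 6 / d <= m%:R -> (forall x, S x -> nu x <= 1) ->
  exists (p : nat) (c : 'I_p -> {ffun T -> R}),
    [/\ (p <= m ^ #|T|)%N, forall i, S (c i) &
        forall x, S x -> exists i, nu (x - c i) <= d].
Proof.
move=> d01 dm S1.
pose sep p (c : 'I_p -> {ffun T -> R}) :=
  (forall i, S (c i)) /\ (forall i j, i != j -> d < nu (c i - c j)).
have ex0 : exists p, `[< exists c, @sep p c >].
  by exists 0%N; apply/asboolP; exists (fun=> 0); split=> [[]|[]].
have bnd p : `[< exists c, @sep p c >] -> (p <= m ^ #|T|)%N.
  by move=> /asboolP[c [cS csep]]; apply: separated_family_size csep => // i; exact: S1.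
case: (ex_maxnP ex0 bnd) => p /asboolP[c [cS csep]] pmax.
exists p, c; split => //; first by apply: bnd; apply/asboolP; exists c.
move=> x Sx; apply: contrapT => xfar.
have far i : d < nu (x - c i).
  by rewrite ltNge; apply/negP => h; apply: xfar; exists i.
have : (p.+1 <= p)%N; last by rewrite ltnn.
apply: pmax; apply/asboolP.
exists (fun i => if unlift ord0 i is Some j then c j else x); split.
  by move=> i; case: unliftP => [j|] _.
move=> i j; case: unliftP => [i'|] ->; case: unliftP => [j'|] -> //.
- by rewrite (inj_eq lift_inj); exact: csep.
- by rewrite -nuN opprB.
Qed.

End LatticeCounting.

(** * Nets of the parameters of a block model *)

Section BlockModelNet.
Variable R : realType.
Local Notation C := R[i].
Local Notation toC := (real_complex R).

Lemma Re_le_norm (z : C) : `|complex.Re z| <= complex.Re `|z|.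
Proof. by rewrite -lecR ReC normc_ge_Re. Qed.

Lemma Im_le_norm (z : C) : `|complex.Im z| <= complex.Re `|z|.
Proof.
rewrite -sqrtr_sqr normc_def /= ler_sqrt ?lerDr ?addr_ge0 ?sqr_ge0 //.
Qed.

Variables (W : finType) (k n : nat) (d : 'I_k -> W).

Definition block_pos : finType := {ab : 'I_k * 'I_k | d ab.1 == d ab.2}.
Definition param : finType := ('I_k * 'I_k + 'I_n * block_pos * bool)%type.

(** The real and imaginary parts of the upper triangle take [k ^ 2] real
    parameters, half of those of a general matrix: this gives the leading
    term of the covering numbers. *)
Definition hermitian_of (x : {ffun param -> R}) : 'M[C]_k :=
  \matrix_(a, b) if (a < b)%N then Complex (x (inl (a, b))) (x (inl (b, a)))
    else if a == b then Complex (x (inl (a, a))) 0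
    else Complex (x (inl (b, a))) (- x (inl (a, b))).

Definition blocks_of (x : {ffun param -> R}) (i : 'I_n) : 'M[C]_k :=
  \matrix_(a, b) if insub (a, b) is Some s
    then Complex (x (inr (i, s, true))) (x (inr (i, s, false))) else 0.

Definition model_of x (o : option 'I_n) : 'M[C]_k :=
  if o is Some i then blocks_of x i else hermitian_of x.

Definition model_norm x : R := \big[Num.max/0]_o opnorm (model_of x o).

Lemma model_normP x o : opnorm (model_of x o) <= model_norm x.
Proof. exact: (le_bigmax _ (fun o => opnorm (model_of x o))). Qed.

Lemma model_norm_le x c : 0 <= c -> (forall o, opnorm (model_of x o) <= c) ->
  model_norm x <= c.
Proof. by move=> c0 h; apply: bigmax_le. Qed.

Lemma model_ofD x y o : model_of (x + y) o = model_of x o + model_of y o.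
Proof.
case: o => [i|]; apply/matrixP => a b; rewrite !mxE.
  by case: insub => [s|]; rewrite ?addr0 // !ffunE.
case: ifP => _; first by rewrite !ffunE.
case: ifP => _; rewrite !ffunE; apply/eqP; rewrite eq_complex /= ?addr0 ?opprD !eqxx //.
Qed.

Lemma model_ofZ (a : R) x o : model_of (a *: x) o = toC a *: model_of x o.
Proof.
case: o => [i|]; apply/matrixP => b c; rewrite !mxE.
  case: insub => [s|]; rewrite ?mulr0 // !ffunE; apply/eqP; rewrite eq_complex /=.
  by rewrite !mul0r subr0 addr0 !eqxx.
case: ifP => _; last case: ifP => _; rewrite !ffunE; apply/eqP; rewrite eq_complex /=;
  by rewrite !mul0r ?mulr0 ?mulrN ?subr0 ?addr0 !eqxx.
Qed.

Lemma model_ofB x y o : model_of (x - y) o = model_of x o - model_of y o.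
Proof. by rewrite model_ofD -scaleN1r model_ofZ rmorphN1 scaleN1r. Qed.

Lemma model_norm_coord : exists c : R, forall (x : {ffun param -> R}) t,
  `|x t| <= c * model_norm x.
Proof.
exists 1 => x t; rewrite mul1r.
case: t => [[a b]|[[i s] c]].
- apply: le_trans (model_normP x None) => /=.
  have [ab|ba|ab] := ltngtP a b.
  + apply: le_trans (opnorm_entry _ a b); rewrite mxE ab.
    exact: (Re_le_norm (Complex _ (x (inl (b, a))))).
  + apply: le_trans (opnorm_entry _ b a); rewrite mxE ba.
    exact: (Im_le_norm (Complex (x (inl (b, a))) _)).
  + apply: le_trans (opnorm_entry _ a b); rewrite mxE (ord_inj ab) ltnn eqxx.
    exact: (Re_le_norm (Complex _ 0)).
- apply: le_trans (model_normP x (Some i)) => /=.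
  apply: le_trans (opnorm_entry _ (val s).1 (val s).2); rewrite mxE.
  rewrite (_ : insub _ = Some s); last by rewrite -surjective_pairing valK.
  by case: c; [exact: (Re_le_norm (Complex _ _))|exact: (Im_le_norm (Complex _ _))].
Qed.

Lemma model_of_onto (H : 'M[C]_k) (Y : 'I_n -> 'M[C]_k) :
  adj H = H -> (forall i a b, d a != d b -> Y i a b = 0) ->
  exists x, hermitian_of x = H /\ forall i, blocks_of x i = Y i.
Proof.
move=> Hh Y0.
exists [ffun t : param => match t with
  | inl (a, b) => if (a <= b)%N then complex.Re (H a b) else complex.Im (H b a)
  | inr (i, s, c) => if c then complex.Re (Y i (val s).1 (val s).2)
                     else complex.Im (Y i (val s).1 (val s).2) end].
have HE a b : H a b = Complex (complex.Re (H b a)) (- complex.Im (H b a)).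
  by rewrite -{1}Hh !mxE; case: (H b a).
split=> [|i]; apply/matrixP => a b; rewrite !mxE.
  have [ab|ba|ab] := ltngtP a b.
  - by rewrite !ffunE (ltnW ab) leqNgt ab /=; case: (H a b).
  - by rewrite -val_eqE (gtn_eqF ba) !ffunE (ltnW ba) leqNgt ba /= [RHS]HE.
  - rewrite (ord_inj ab) eqxx ffunE leqnn.
    have := HE b b; case: (H b b) => u v [vv]; congr Complex; clear HE Y0; lra.
case: insubP => [s ds sE|].
  by rewrite !ffunE sE /=; case: (Y i a b).
by move=> /= /Y0 ->.
Qed.

Lemma card_param :
  #|param| = (k * k + 2 * n * #|[pred ab : 'I_k * 'I_k | d ab.1 == d ab.2]|)%N.
Proof.
rewrite card_sum !card_prod !card_ord card_bool card_sig; congr (_ + _)%N.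
by rewrite mulnC mulnA.
Qed.

(** The net of the parameters of a block model: the Hermitian part encodes a
    unitary, the other part [n] matrices supported on the blocks of [d]. *)
Lemma block_model_net (e : R) (m : nat) (S : set ('M[C]_k * ('I_n -> 'M[C]_k))) :
  0 < e <= 1 -> 6 / e <= m%:R ->
  (forall HY, S HY -> [/\ adj HY.1 = HY.1, opnorm HY.1 <= 1,
     forall i a b, d a != d b -> HY.2 i a b = 0 & forall i, opnorm (HY.2 i) <= 1]) ->
  exists (p : nat) (c : 'I_p -> 'M[C]_k * ('I_n -> 'M[C]_k)),
    [/\ (p <= m ^ (k * k + 2 * n * #|[pred ab : 'I_k * 'I_k | d ab.1 == d ab.2]|))%N,
        forall j, S (c j) &
        forall HY, S HY -> exists j, opnorm (HY.1 - (c j).1) <= e /\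
          forall i, opnorm (HY.2 i - (c j).2 i) <= e].
Proof.
move=> e01 em SP.
have nuD x y : model_norm (x + y) <= model_norm x + model_norm y.
  apply: model_norm_le => [|o].
    by rewrite addr_ge0 //; apply: le_trans (opnorm_ge0 _) (model_normP _ None).
  rewrite model_ofD; apply: le_trans (opnormD _ _) _.
  by apply: lerD; exact: model_normP.
have nuZ (a : R) x : model_norm (a *: x) = `|a| * model_norm x.
  have le1 (b : R) y : model_norm (b *: y) <= `|b| * model_norm y.
    have y0 : 0 <= model_norm y by apply: le_trans (opnorm_ge0 _) (model_normP _ None).
    apply: model_norm_le => [|o]; first exact: mulr_ge0.
    by rewrite model_ofZ opnormZR; apply: ler_wpM2l => //; exact: model_normP.
  apply/le_anti; rewrite le1 /=.
  have [->|a0] := eqVneq a 0.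
    by rewrite normr0 mul0r; apply: le_trans (opnorm_ge0 _) (model_normP _ None).
  rewrite -{1}(scalerK a0 x) -ler_pdivlMl ?normr_gt0 //.
  by rewrite -normfV; exact: le1.
pose pr x : 'M[C]_k * ('I_n -> 'M[C]_k) := (hermitian_of x, blocks_of x).
have onto HY : S HY -> exists x, pr x = HY.
  move=> /SP[h1 _ h3 _]; have [x [x1 x2]] := model_of_onto h1 h3.
  exists x; rewrite /pr x1 [HY]surjective_pairing; congr pair.
  by apply/funext => i; exact: x2.
have [|p [c [pm cS cP]]] :=
  @internal_net R param _ nuD nuZ model_norm_coord e m (S \o pr) e01 em.
  by move=> x /SP[_ h2 _ h4]; apply: (model_norm_le ler01) => -[i|];
    [exact: h4|exact: h2].
exists p, (pr \o c); split => //; first by rewrite -card_param.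
move=> HY SHY; have [x xHY] := onto _ SHY.
have [j xj] : exists j, model_norm (x - c j) <= e by apply: cP; rewrite /= xHY.
exists j; rewrite -xHY /=; split=> [|i].
  by have := le_trans (model_normP _ None) xj; rewrite model_ofB.
by have := le_trans (model_normP _ (Some i)) xj; rewrite model_ofB.
Qed.

End BlockModelNet.

(** * Norm estimates and almost central partitions in a C*-algebra *)

Section CStarNorm.
Variables (R : realType) (A : cstarType R).
Local Notation toC := (real_complex R).
Implicit Types a b : A.

Lemma cnormE a : toC (cnorm a) = `|a|.
Proof. by rewrite RRe_real // ger0_real. Qed.

Lemma cnorm_ge0 a : 0 <= cnorm a.
Proof. by rewrite -ler0c cnormE. Qed.

Lemma cnormD a b : cnorm (a + b) <= cnorm a + cnorm b.
Proof. by rewrite -lecR rmorphD /= !cnormE ler_normD. Qed.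

Lemma cnormM a b : cnorm (a * b) <= cnorm a * cnorm b.
Proof. by rewrite -lecR rmorphM /= !cnormE; exact: cnormM_le. Qed.

Lemma cnormN a : cnorm (- a) = cnorm a.
Proof. by rewrite /cnorm normrN. Qed.

Lemma cnorm0 : cnorm (0 : A) = 0.
Proof. by rewrite /cnorm normr0. Qed.

Lemma cnormZ (c : R[i]) a : cnorm (c *: a) = complex.Re `|c| * cnorm a.
Proof. by apply: (@complexI R); rewrite rmorphM /= ReC !cnormE normrZ. Qed.

Lemma cnorm_eq0 a : cnorm a = 0 -> a = 0.
Proof. by move=> h; apply/eqP; rewrite -normr_eq0 -cnormE h. Qed.

Lemma cstar_norm_sqr a : cnorm (star a * a) = cnorm a ^+ 2.
Proof. by apply: (@complexI R); rewrite cnormE rmorphXn /= cnormE;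
  exact: cstar_identity. Qed.

Lemma cnorm_le_star a : cnorm a <= cnorm (star a).
Proof.
have [->|a0] := eqVneq (cnorm a) 0; first exact: cnorm_ge0.
have a_gt0 : 0 < cnorm a by rewrite lt_def a0 cnorm_ge0.
by rewrite -(ler_pM2r a_gt0) -expr2 -cstar_norm_sqr cnormM.
Qed.

Lemma cnorm_star a : cnorm (star a) = cnorm a.
Proof. by apply/le_anti; rewrite cnorm_le_star -{2}(starK a) cnorm_le_star. Qed.

Lemma starMr a b : star (a * b) = star b * star a.
Proof. exact: starM. Qed.

Lemma starDr a b : star (a + b) = star a + star b.
Proof. exact: starD. Qed.

Lemma starZr (c : R[i]) a : star (c *: a) = Num.conj c *: star a.
Proof. exact: starZ. Qed.

Lemma star1 : star (1 : A) = 1.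
Proof.
have h : star (1 : A) * 1 = star 1 by rewrite mulr1.
by rewrite -[RHS]starK -h starMr starK mulr1.
Qed.

(** The C*-identity turns the hypothesis into [c ^ 2 <= max 1 c] for the norm
    [c] of [a]; both isometries and projections satisfy it. *)
Lemma cnorm_contraction a : cnorm (star a * a) <= Num.max 1 (cnorm a) -> cnorm a <= 1.
Proof.
rewrite cstar_norm_sqr => h; rewrite leNgt; apply/negP => a1.
by move: h; rewrite (max_r (ltW a1)); move: (cnorm a) a1 => t; clear; nra.
Qed.

Lemma cnorm1 : cnorm (1 : A) <= 1.
Proof. by apply: cnorm_contraction; rewrite star1 mulr1 le_max lexx orbT. Qed.

Lemma cnorm_isometry a : star a * a = 1 -> cnorm a <= 1.
Proof. by move=> h; apply: cnorm_contraction; rewrite h le_max cnorm1. Qed.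

Lemma cnorm_projection a : star a = a -> a * a = a -> cnorm a <= 1.
Proof. by move=> h1 h2; apply: cnorm_contraction; rewrite h1 h2 le_max lexx orbT. Qed.

End CStarNorm.

Section CyclicShift.
Variable R : realType.
Local Notation C := R[i].

(** A proper colouring of a cycle by parity, with a third colour for the last
    point, as odd cycles require. *)
Definition cycle_colour k (a : 'I_k) : 'I_3 :=
  if a.+1 == k then inord 2 else inord (odd a).

Lemma cycle_colour_ordS k (a : 'I_k) : (1 < k)%N ->
  cycle_colour (ordS a) != cycle_colour a.
Proof.
move=> k2; rewrite /cycle_colour -val_eqE /=.
have [ak|ak] := eqVneq a.+1 k.
  by rewrite ak modnn (ltn_eqF k2) !inordK.
have ak' : (a.+1 < k)%N by rewrite ltn_neqAle ak /=.
by rewrite modn_small //; case: ifP => _; rewrite !inordK //=; case: (odd a).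
Qed.

Definition colour_proj k (j : 'I_3) : 'M[C]_k :=
  diag_mx (\row_a (cycle_colour a == j)%:R).

Definition shift_mx k : 'M[C]_k := \matrix_(a, b) (a == ordS b)%:R.

Lemma colour_proj_herm k j : adj (colour_proj k j) = colour_proj k j.
Proof.
rewrite tr_diag_mx map_diag_mx; congr diag_mx; apply/rowP => a; rewrite !mxE.
by case: eqP => _; rewrite ?rmorph1 ?rmorph0.
Qed.

Lemma colour_projM k i j :
  colour_proj k i *m colour_proj k j = (i == j)%:R *: colour_proj k i.
Proof.
rewrite mulmx_diag -linearZ /=; congr diag_mx; apply/rowP => a; rewrite !mxE.
have [ai|] := eqVneq (cycle_colour a) i; last by rewrite mul0r mulr0.
by rewrite ai mul1r mulr1.
Qed.

Lemma sum_colour_proj k : \sum_j colour_proj k j = 1%:M.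
Proof.
rewrite -linear_sum /=.
have -> : \sum_j (\row_a (cycle_colour a == j)%:R : 'rV[C]_k) = const_mx 1.
  apply/rowP => a; rewrite summxE (bigD1 (cycle_colour a)) //= big1 => [|j jd].
    by rewrite !mxE eqxx addr0.
  by rewrite mxE eq_sym (negbTE jd).
by rewrite diag_const_mx.
Qed.

Lemma shift_mx_isometry k : adj (shift_mx k) *m shift_mx k = 1%:M.
Proof.
apply/matrixP => a b; rewrite !mxE (bigD1 (ordS b)) //= big1 => [|c cb].
  rewrite !mxE eqxx mulr1 addr0 (inj_eq (@ordS_inj k)) eq_sym.
  by case: eqP => _; rewrite ?rmorph1 ?rmorph0.
by rewrite !mxE (negbTE cb) mulr0.
Qed.

Lemma colour_shift k j : (1 < k)%N ->
  colour_proj k j *m shift_mx k *m colour_proj k j = 0.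
Proof.
move=> k2; apply/matrixP => a b; rewrite mul_mx_diag mul_diag_mx !mxE.
have [ab|_] := eqVneq a (ordS b); last by rewrite mulr0 mul0r.
have := cycle_colour_ordS b k2; rewrite -ab => ne.
have [aj|] := eqVneq (cycle_colour a) j; last by rewrite !mul0r.
by rewrite -aj eq_sym (negbTE ne) mulr0.
Qed.

Variable A : cstarType R.

(** One application of approximate divisibility.  All blocks having size at
    least two, the cyclic shift [v] of their bases moves every colour class off
    itself, so that each colour projection is orthogonal to its shift.  There
    are three colours whatever the blocks are: their number does not depend on
    the finite-dimensional subalgebra, hence neither on [F] nor on [e]. *)
Lemma appdiv_shift (F : seq A) (e : R) : approximately_divisible A -> 0 < e ->
  exists (q : 'I_3 -> A) (v : A),
    [/\ forall i, star (q i) = q i, forall i j, q i * q j = (i == j)%:R *: q i,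
        \sum_i q i = 1, star v * v = 1 & forall i, q i * v * q i = 0] /\
    [/\ forall i y, y \in F -> cnorm (y * q i - q i * y) < e,
        forall y, y \in F -> cnorm (y * v - v * y) < e &
        forall y, y \in F -> cnorm (y * star v - star v * y) < e].
Proof.
move=> Adiv e0.
have [B [[_ _ _ Bstar _] _ B1 Brank Bcomm]] := Adiv (size F) (fun i => nth 0 F i) e e0.
have comm y b : y \in F -> B b -> cnorm b <= 1 -> cnorm (y * b - b * y) < e.
  move=> yF Bb b1; have yF' : (index y F < size F)%N by rewrite index_mem.
  by have := Bcomm (Ordinal yF') b Bb b1; rewrite /= nth_index.
have [r [k [f [k2 [flin fmul fstar finj fB]]]]] : exists (r : nat) (k : 'I_r.+1 -> nat)
    (f : (forall i, 'M[C]_(k i)) -> A),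
    (forall i, (1 < k i)%N) /\ is_matrix_sum_iso B f.
  move: Brank; rewrite /SubRank; case: xgetP => [s _ [r [k [f [k0 fiso ->]]]]|] // k2.
  exists r, k, f; split=> // i; apply: leq_trans k2 _.
  elim: (index_enum _) (mem_index_enum i) => // j s' IHs; rewrite big_cons inE.
  case/predU1P => [<-|/IHs]; first exact: geq_minl.
  by apply: leq_trans; exact: geq_minr.
have Bf M : B (f M) by rewrite -fB; exists M.
have f1 : f (fun i => 1%:M) = 1.
  have [M _ fM] : range f 1 by rewrite fB.
  have := fmul (fun i => 1%:M) M; rewrite fM mulr1 => <-.
  by rewrite -fM; congr f; apply: functional_extensionality_dep => i; rewrite mul1mx.
have fD M N : f (fun i => M i + N i) = f M + f N.
  rewrite -[f M]scale1r -flin; congr f.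
  by apply: functional_extensionality_dep => i; rewrite scale1r.
have f0 : f (fun i => 0) = 0.
  apply: (addrI (f (fun i => 0))); rewrite addr0 -fD; congr f.
  by apply: functional_extensionality_dep => i; rewrite addr0.
have fZ c M : f (fun i => c *: M i) = c *: f M.
  rewrite -[RHS]addr0 -f0 -flin; congr f.
  by apply: functional_extensionality_dep => i; rewrite addr0.
have fsum (I : Type) (s : seq I) (F' : I -> forall i, 'M[C]_(k i)) :
    \sum_(j <- s) f (F' j) = f (fun i => \sum_(j <- s) F' j i).
  elim: s => [|j s IHs].
    by rewrite big_nil -f0; congr f; apply: functional_extensionality_dep => i;
      rewrite big_nil.
  rewrite big_cons IHs -fD; congr f.
  by apply: functional_extensionality_dep => i; rewrite big_cons.
pose q j := f (fun i => colour_proj (k i) j).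
pose v := f (fun i => shift_mx (k i)).
have qstar i : star (q i) = q i.
  by rewrite -fstar; congr f; apply: functional_extensionality_dep => l;
    exact: colour_proj_herm.
have qq i j : q i * q j = (i == j)%:R *: q i.
  rewrite -fmul -fZ; congr f.
  by apply: functional_extensionality_dep => l; exact: colour_projM.
have vv : star v * v = 1.
  rewrite -fstar -fmul -f1; congr f.
  by apply: functional_extensionality_dep => l; exact: shift_mx_isometry.
have Bq i : B (q i) by exact: Bf.
have Bv : B v by exact: Bf.
exists q, v; split; split.
- exact: qstar.
- exact: qq.
- rewrite /q fsum -f1; congr f.
  by apply: functional_extensionality_dep => l; exact: sum_colour_proj.
- exact: vv.
- move=> i; rewrite /q /v -!fmul -f0; congr f.
  by apply: functional_extensionality_dep => l; exact: colour_shift.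
- move=> i y yF; apply: comm => //.
  by apply: cnorm_projection => //; rewrite qq eqxx scale1r.
- by move=> y yF; apply: comm => //; exact: cnorm_isometry.
- move=> y yF; apply: comm => //; first exact: Bstar.
  by rewrite cnorm_star; exact: cnorm_isometry.
Qed.

End CyclicShift.

Section AlmostCentralPartition.
Variables (R : realType) (A : cstarType R).
Implicit Types a b c : A.

Lemma cnorm_tri b a c e1 e2 :
  cnorm (a - b) <= e1 -> cnorm (b - c) <= e2 -> cnorm (a - c) <= e1 + e2.
Proof.
move=> h1 h2; have -> : a - c = (a - b) + (b - c) by rewrite addrA subrK.
exact: le_trans (cnormD _ _) (lerD h1 h2).
Qed.

Lemma cnormB a b : cnorm (a - b) = cnorm (b - a).
Proof. by rewrite -cnormN opprB. Qed.

Lemma cnormM_le1 a b : cnorm a <= 1 -> cnorm b <= 1 -> cnorm (a * b) <= 1.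
Proof.
move=> a1 b1; apply: le_trans (cnormM _ _) _.
by rewrite -[leRHS]mul1r; apply: ler_pM => //; exact: cnorm_ge0.
Qed.

Lemma cnorm_between c c' a b e : cnorm c <= 1 -> cnorm c' <= 1 ->
  cnorm (a - b) <= e -> cnorm (c * a * c' - c * b * c') <= e.
Proof.
move=> c1 c1' ab; rewrite -mulrBl -mulrBr.
apply: le_trans ab; apply: le_trans (cnormM _ _) _.
rewrite -[leRHS]mulr1; apply: ler_pM; rewrite ?cnorm_ge0 //.
apply: le_trans (cnormM _ _) _.
by rewrite -[leRHS]mul1r; apply: ler_pM; rewrite ?cnorm_ge0.
Qed.

Lemma cnorm_delta (p : bool) a : cnorm a <= 1 -> cnorm (p%:R *: a) <= 1.
Proof. by case: p => a1; rewrite ?scale1r // scale0r cnorm0. Qed.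

(** The pieces [g w] are almost projections with [#|U|] almost orthogonal
    isometric copies: [s u] moves a piece to its copy and [r u] brings it back.
    The [r u] play the role of the adjoints of the [s u]; as separate elements
    they can be approximated by polynomials independently. *)
Definition almost_central_partition (W U : finType) (F : seq A) (e : R)
    (g : W -> A) (r s : U -> A) : Prop :=
  [/\ \sum_w g w = 1,
      [/\ forall w, cnorm (g w) <= 1, forall u, cnorm (r u) <= 1
        & forall u, cnorm (s u) <= 1],
      forall w w', cnorm (g w * g w' - (w == w')%:R *: g w) <= e,
      forall w, cnorm (star (g w) - g w) <= e
    & (forall w u u', cnorm (g w * r u * s u' * g w - (u == u')%:R *: g w) <= e) /\
      (forall w y, y \in F -> cnorm (y * g w - g w * y) <= e)].

Fixpoint piece t : finType := if t is t'.+1 then (piece t' * 'I_3)%type else unit.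
Fixpoint copy t : finType := if t is t'.+1 then (copy t' * bool)%type else unit.

Lemma card_copy t : #|copy t| = (2 ^ t)%N.
Proof. by elim: t => [|t IHt];
  rewrite /= ?card_unit // card_prod IHt card_bool expnSr. Qed.

(** Each application of approximate divisibility, to [F] and the partition
    already found, doubles the number of copies: the new pieces are [g w * q i]
    and the new copies are moved by [s u] and by [s u * v].  The number of pieces
    is [3 ^ t], independently of the error [e]. *)
Lemma exists_almost_central_partition t (F : seq A) (e : R) :
  approximately_divisible A -> 0 < e ->
  exists (g : piece t -> A) (r s : copy t -> A), almost_central_partition F e g r s.
Proof.
move=> Adiv; elim: t e F => [|t IHt] e F e0.
  exists (fun=> 1), (fun=> 1), (fun=> 1); split.
  - rewrite (bigD1 tt) //= big1 ?addr0 // => -[]; rewrite eqxx //.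
  - by split=> *; exact: cnorm1.
  - by move=> [] []; rewrite eqxx scale1r mulr1 subrr cnorm0 ltW.
  - by move=> _; rewrite star1 subrr cnorm0 ltW.
  - split=> [_ [] []|_ y _]; first by rewrite eqxx scale1r !mulr1 subrr cnorm0 ltW.
    by rewrite mul1r mulr1 subrr cnorm0 ltW.
(* Seven commutations reduce the relation of the new copies to the old one. *)
pose e' := e / 7.
have e'0 : 0 < e' by rewrite divr_gt0.
have [g [r [s [gsum [g1 r1 s1] gg gstar [grs gF]]]]] := IHt e' F e'0.
have [q [v [[qstar qq qsum vv qvq] [qF vF vsF]]]] :=
  appdiv_shift (codom g ++ F) Adiv e'0.
have qg i w : cnorm (q i * g w - g w * q i) <= e'.
  by rewrite cnormB ltW // qF // mem_cat codom_f.
have vg w : cnorm (v * g w - g w * v) <= e'.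
  by rewrite cnormB ltW // vF // mem_cat codom_f.
have vsg w : cnorm (star v * g w - g w * star v) <= e'.
  by rewrite cnormB ltW // vsF // mem_cat codom_f.
have q1 i : cnorm (q i) <= 1 by apply: cnorm_projection => //; rewrite qq eqxx scale1r.
have v1 : cnorm v <= 1 by exact: cnorm_isometry.
have vs1 : cnorm (star v) <= 1 by rewrite cnorm_star.
pose vp (b : bool) : A := if b then v else 1.
pose vm (b : bool) : A := if b then star v else 1.
have vp1 (b : bool) : cnorm (vp b) <= 1 by case: b => //; exact: cnorm1.
have vm1 (b : bool) : cnorm (vm b) <= 1 by case: b => //; exact: cnorm1.
have vpg (b : bool) w : cnorm (vp b * g w - g w * vp b) <= e'.
  by case: b => //; rewrite mul1r mulr1 subrr cnorm0 ltW.
have vmg (b : bool) w : cnorm (vm b * g w - g w * vm b) <= e'.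
  by case: b => //; rewrite mul1r mulr1 subrr cnorm0 ltW.
have qvv i (b b' : bool) : q i * vm b * vp b' * q i = (b == b')%:R *: q i.
  have qvsq : q i * star v * q i = 0.
    have := congr1 star (qvq i); rewrite !starMr qstar => h; rewrite -mulrA [LHS]h.
    by apply: cnorm_eq0; rewrite cnorm_star cnorm0.
  case: b b' => [] [] /=; rewrite /vm /vp ?mulr1 ?scale0r ?scale1r //.
    by rewrite -(mulrA (q i)) vv mulr1 qq eqxx scale1r.
  by rewrite qq eqxx scale1r.
exists (fun wi => g wi.1 * q wi.2), (fun ub => vm ub.2 * r ub.1),
  (fun ub => s ub.1 * vp ub.2).
split.
- rewrite -(pair_bigA _ (fun w i => g w * q i)) /=.
  under eq_bigr do rewrite -mulr_sumr qsum mulr1.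
  exact: gsum.
- by split=> -[w i]; exact: cnormM_le1.
- move=> [w i] [w' i'] /=; rewrite xpair_eqE.
  apply: le_trans (_ : e' + e' <= _); last by rewrite /e'; clear -e0; lra.
  apply: (cnorm_tri (b := g w * g w' * ((i == i')%:R *: q i))).
    have := cnorm_between (g1 w) (q1 i') (qg i w').
    by rewrite !mulrA -(mulrA _ (q i) (q i')) qq.
  have := cnorm_between (cnorm1 A) (cnorm_delta (i == i') (q1 i)) (gg w w').
  rewrite !mul1r; have -> // : (w == w')%:R *: g w * ((i == i')%:R *: q i)
      = ((w == w') && (i == i'))%:R *: (g w * q i).
  by rewrite -scalerAl -scalerAr scalerA -natrM mulnb.
- move=> [w i] /=.
  apply: le_trans (_ : e' + e' <= _); last by rewrite /e'; clear -e0; lra.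
  apply: (cnorm_tri (b := q i * g w)) (qg i w).
  have := cnorm_between (q1 i) (cnorm1 A) (gstar w).
  by rewrite !mulr1 starMr qstar.
split.
- move=> [w i] [u b] [u' b'] /=; rewrite xpair_eqE.
  have gq : cnorm (g w * q i - q i * g w) <= e' by rewrite cnormB.
  apply: le_trans (_ : e' + (e' + (e' + (e' + (e' + (e' + e'))))) <= _); last first.
    by rewrite /e'; clear -e0; lra.
  have m1 : cnorm (vm b * r u) <= 1 by exact: cnormM_le1.
  have m2 : cnorm (s u' * vp b' * g w * q i) <= 1 by do !apply: cnormM_le1.
  have m3 : cnorm (q i * vm b) <= 1 by exact: cnormM_le1.
  have m4 : cnorm (vp b' * q i) <= 1 by exact: cnormM_le1.
  have m5 : cnorm (r u * s u' * vp b' * g w * q i) <= 1 by do !apply: cnormM_le1.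
  have m6 : cnorm (q i * vm b * g w * r u * s u') <= 1 by do !apply: cnormM_le1.
  pose D : R[i] := (u == u')%:R.
  apply: (cnorm_tri (b := q i * g w * vm b * (r u * s u' * vp b' * g w * q i))).
    by have := cnorm_between (cnorm1 A) (cnormM_le1 (vm1 b) m5) gq;
      rewrite !mul1r !mulrA.
  apply: (cnorm_tri (b := q i * vm b * g w * (r u * s u' * vp b' * g w * q i))).
    have gv : cnorm (g w * vm b - vm b * g w) <= e' by rewrite cnormB.
    by have := cnorm_between (q1 i) m5 gv; rewrite !mulrA.
  apply: (cnorm_tri (b := q i * vm b * g w * r u * s u' * g w * vp b' * q i)).
    by have := cnorm_between m6 (q1 i) (vpg b' w); rewrite !mulrA.
  apply: (cnorm_tri (b := q i * vm b * (D *: g w) * (vp b' * q i))).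
    by have := cnorm_between m3 m4 (grs w u u'); rewrite !mulrA.
  apply: (cnorm_tri (b := D *: (q i * vm b * vp b' * (g w * q i)))).
    have gv : cnorm (D *: (g w * vp b') - D *: (vp b' * g w)) <= e'.
      rewrite -scalerBr; have gv : cnorm (g w * vp b' - vp b' * g w) <= e'
        by rewrite cnormB.
      by rewrite /D; case: (u == u'); rewrite ?scale1r // scale0r cnorm0 ltW.
    have := cnorm_between m3 (q1 i) gv.
    by rewrite -!scalerAr -!scalerAl !mulrA.
  have Dle (a b0 : A) : cnorm (a - b0) <= e' -> cnorm (D *: a - D *: b0) <= e'.
    by rewrite -scalerBr /D; case: (u == u') => h;
      rewrite ?scale1r // scale0r cnorm0 ltW.
  apply: (cnorm_tri (b := D *: (q i * vm b * vp b' * (q i * g w)))).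
    by apply: Dle; have := cnorm_between (cnormM_le1 m3 (vp1 b')) (cnorm1 A) gq;
      rewrite !mulr1.
  rewrite mulrA qvv -scalerAl scalerA -natrM mulnb -scalerBr.
  by case: (_ && _); rewrite ?scale1r // scale0r cnorm0 ltW.
- move=> [w i] y yF /=.
  apply: le_trans (_ : e' + e' <= _); last by rewrite /e'; clear -e0; lra.
  apply: (cnorm_tri (b := g w * y * q i)).
    by have := cnorm_between (cnorm1 A) (q1 i) (gF w y yF); rewrite !mul1r !mulrA.
  have yqi : cnorm (y * q i - q i * y) <= e' by rewrite ltW // qF // mem_cat yF orbT.
  by have := cnorm_between (g1 w) (cnorm1 A) yqi; rewrite !mulr1 !mulrA.
Qed.

End AlmostCentralPartition.

(** * Noncommutative polynomials with rational coefficients *)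

Section NcPolynomials.
Variables (R : realType) (n : nat).
Local Notation C := R[i].
Local Notation toC := (real_complex R).

Section Evaluation.
Variables (B : algType C) (x : 'I_n -> B).
Implicit Types p q : ncpoly R n.

Lemma ncevalD p q : nceval x (p + q) = nceval x p + nceval x q.
Proof. exact: mmapD. Qed.

Lemma ncevalB p q : nceval x (p - q) = nceval x p - nceval x q.
Proof. exact: mmapB. Qed.

Lemma nceval_monom c (w : fmonom 'I_n) :
  nceval x (mkmalgU w c) = c *: \prod_(i <- w) x i.
Proof. by rewrite /nceval mmapU mulr_algl. Qed.

Lemma nceval_const c : nceval x (mkmalgU mone c) = c%:A.
Proof. by rewrite nceval_monom fm1 big_nil. Qed.

Lemma nceval_var i : nceval x (mkmalgU (fmu i) 1) = x i.
Proof. by rewrite nceval_monom fmU big_seq1 scale1r. Qed.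

Lemma ncevalM p q : nceval x (p * q) = nceval x p * nceval x q.
Proof.
rewrite malgME [nceval x p]/nceval mmapE mulr_suml.
have ncsum (I : Type) (s : seq I) (F : I -> ncpoly R n) :
    nceval x (\sum_(i <- s) F i) = \sum_(i <- s) nceval x (F i).
  by rewrite /nceval raddf_sum.
rewrite ncsum; apply: eq_bigr => w _; rewrite ncsum [nceval x q]/nceval mmapE mulr_sumr.
apply: eq_bigr => w' _; rewrite nceval_monom !mulr_algl fmM big_cat /=.
by rewrite -scalerAl -scalerAr scalerA.
Qed.

End Evaluation.

Definition rational_scalar (z : C) : Prop :=
  exists a b : rat, z = Complex (ratr a) (ratr b).

Lemma rational_scalar0 : rational_scalar 0.
Proof. by exists 0, 0; rewrite rmorph0. Qed.

Lemma rational_scalarD z z' : rational_scalar z -> rational_scalar z' ->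
  rational_scalar (z + z').
Proof. by move=> [a [b ->]] [c [e ->]]; exists (a + c), (b + e); rewrite !rmorphD. Qed.

Lemma rational_scalarM z z' : rational_scalar z -> rational_scalar z' ->
  rational_scalar (z * z').
Proof.
move=> [a [b ->]] [c [e ->]]; exists (a * c - b * e), (a * e + b * c).
by rewrite rmorphB rmorphD !rmorphM.
Qed.

Lemma rational_scalar_conj z : rational_scalar z -> rational_scalar (Num.conj z).
Proof. by move=> [a [b ->]]; exists a, (- b); rewrite rmorphN. Qed.

Lemma rational_ncpolyD (p q : ncpoly R n) : rational_ncpoly R n p ->
  rational_ncpoly R n q ->
  rational_ncpoly R n (p + q).
Proof. by move=> pr qr w; rewrite mcoeffD; exact: rational_scalarD. Qed.

Lemma rational_ncpolyM (p q : ncpoly R n) : rational_ncpoly R n p ->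
  rational_ncpoly R n q ->
  rational_ncpoly R n (p * q).
Proof.
move=> pr qr w; rewrite mcoeffMl; apply: (@big_ind _ rational_scalar) => [||w1 _].
- exact: rational_scalar0.
- exact: rational_scalarD.
apply: (@big_ind _ rational_scalar) => [||w2 _].
- exact: rational_scalar0.
- exact: rational_scalarD.
case: eqP => _; last by rewrite mulr0n; exact: rational_scalar0.
by rewrite mulr1n; apply: rational_scalarM.
Qed.

Lemma rational_monom w c : rational_scalar c -> rational_ncpoly R n (mkmalgU w c).
Proof.
move=> cr w'; rewrite mcoeffU; case: eqP => _; first by rewrite mulr1n.
by rewrite mulr0n; exact: rational_scalar0.
Qed.

Lemma rational_scalar_nat m : rational_scalar m%:R.
Proof. by exists m%:R, 0; rewrite rmorph0 ratr_nat; apply/eqP;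
  rewrite -[m%:R](rmorph_nat toC). Qed.

Lemma rational_scalarN1 : rational_scalar (-1).
Proof. by exists (-1), 0; rewrite rmorph0 rmorphN1; apply/eqP;
  rewrite eq_complex /= oppr0 !eqxx. Qed.

Lemma rational_dense (c : C) (e : R) : 0 < e ->
  exists2 z, rational_scalar z & complex.Re `|z - c| <= e.
Proof.
move=> e0; have approx (u : R) : exists a : rat, `|ratr a - u| <= e / 2.
  have [|a] := @rat_in_itvoo R (u - e / 2) (u + e / 2); first by clear -e0; lra.
  rewrite in_itv /= => /andP[h1 h2]; exists a; rewrite ler_norml; apply/andP.
  by clear -h1 h2; split; lra.
have [a ha] := approx (complex.Re c); have [b hb] := approx (complex.Im c).
exists (Complex (ratr a) (ratr b)); first by exists a, b.
rewrite -lecR ReC.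
have -> : Complex (ratr a) (ratr b) - c
    = toC (ratr a - complex.Re c) + Complex 0 1 * toC (ratr b - complex.Im c).
  by rewrite [c in LHS]complexE; apply/eqP; rewrite eq_complex /=; apply/andP;
    split; apply/eqP; ring.
have nt (u : R) : `|toC u| = toC `|u| by rewrite -ReC Re_norm_toC.
apply: le_trans (ler_normD _ _) _; rewrite normrM !nt.
rewrite [ `|Complex 0 1|]normc_def /= expr0n expr1n add0r sqrtr1 mul1r -rmorphD lecR.
by clear -ha hb; lra.
Qed.

End NcPolynomials.

Section Density.
Variables (R : realType) (A : cstarType R) (n : nat) (x : 'I_n -> A).
Hypothesis x_sa : forall i, star (x i) = x i.
Local Notation C := R[i].

(** [q] is a formal adjoint of [p], as seen on [x] and on all self-adjoint
    tuples of matrices: it gives access to the Hermitian part of [p] there. *)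
Definition adjoint_pair (p q : ncpoly R n) : Prop :=
  [/\ rational_ncpoly R n p, rational_ncpoly R n q, nceval x q = star (nceval x p)
    & forall k (M : 'I_n -> 'M[C]_k.+1), (forall i, adj (M i) = M i) ->
        nceval M q = adj (nceval M p)].

Lemma adjoint_pair_sym p q : adjoint_pair p q -> adjoint_pair q p.
Proof.
move=> [pr qr qE qM]; split; [exact: qr|exact: pr|by rewrite qE starK|].
by move=> k M Mh; rewrite (qM k M Mh) adjK.
Qed.

Lemma adjoint_pairD p q p' q' : adjoint_pair p q -> adjoint_pair p' q' ->
  adjoint_pair (p + p') (q + q').
Proof.
move=> [pr qr qE qM] [pr' qr' qE' qM']; split => [|||k M Mh].
- exact: rational_ncpolyD.
- exact: rational_ncpolyD.
- by rewrite !ncevalD qE qE' starDr.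
- by rewrite !ncevalD (qM k M Mh) (qM' k M Mh) adjD.
Qed.

Lemma adjoint_pairM p q p' q' : adjoint_pair p q -> adjoint_pair p' q' ->
  adjoint_pair (p * p') (q' * q).
Proof.
move=> [pr qr qE qM] [pr' qr' qE' qM']; split => [|||k M Mh].
- exact: rational_ncpolyM.
- exact: rational_ncpolyM.
- apply: etrans (ncevalM x q' q) _; rewrite qE qE' -starMr.
  exact: (congr1 (fun a : A => star a) (esym (ncevalM x p p'))).
- apply: etrans (ncevalM M q' q) _; rewrite (qM k M Mh) (qM' k M Mh) -adjMr.
  by rewrite ncevalM.
Qed.

Lemma adjoint_pair_const c : rational_scalar c ->
  adjoint_pair (mkmalgU mone c) (mkmalgU mone (Num.conj c)).
Proof.
move=> cr; split => [|||k M Mh].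
- exact: rational_monom.
- exact/rational_monom/rational_scalar_conj.
- apply: etrans (nceval_const x _) _; apply: esym.
  by apply: etrans (congr1 (fun a : A => star a) (nceval_const x c)) _;
    rewrite starZr star1.
- apply: etrans (nceval_const M _) _; apply: esym.
  by rewrite nceval_const linearZ /= map_mxZ trmx1 map_mx1.
Qed.

Lemma adjoint_pair_var i : adjoint_pair (mkmalgU (fmu i) 1) (mkmalgU (fmu i) 1).
Proof.
have r1 : rational_ncpoly R n (mkmalgU (fmu i) 1).
  exact/rational_monom/(rational_scalar_nat R 1).
split; [exact: r1|exact: r1|by rewrite !nceval_var x_sa|].
by move=> k M Mh; rewrite !nceval_var Mh.
Qed.

(** The limits of rational polynomials with formal adjoints form a
    C*-subalgebra, hence everything. *)
Lemma rational_polys_dense (a : A) (e : R) : generated_by x -> 0 < e ->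
  exists p q, adjoint_pair p q /\ cnorm (nceval x p - a) <= e.
Proof.
move=> xgen e0.
pose D : set A := [set a | forall e, 0 < e -> exists p q,
  adjoint_pair p q /\ cnorm (nceval x p - a) <= e].
suff DT : D = setT by have h : D a; [rewrite DT|exact: h e e0].
have constD c : D c%:A.
  move=> {a e e0} e e0; have [z zr zc] := rational_dense c e0.
  exists (mkmalgU mone z), (mkmalgU mone (Num.conj z)); split;
    first exact: adjoint_pair_const.
  rewrite nceval_const -scalerBl cnormZ -[leRHS]mulr1.
  by apply: ler_pM => //; [exact: Re_normC_ge0|exact: cnorm_ge0|exact: cnorm1].
have mulD (b c : A) : D b -> D c -> D (b * c).
  move=> bD cD d d0.
  (* Both errors being at most [f <= 1], the error of the product is at most
     [f * K]. *)
  pose K := cnorm b + cnorm c + 1.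
  have K1 : 1 <= K by rewrite /K lerDr addr_ge0 ?cnorm_ge0.
  pose f := Num.min 1 (d / K).
  have f0 : 0 < f by rewrite lt_min ltr01 divr_gt0 // (lt_le_trans ltr01).
  have [p [q [pq pb]]] := bD f f0; have [p' [q' [pq' pc]]] := cD f f0.
  exists (p * p'), (q' * q); split; first exact: adjoint_pairM.
  rewrite ncevalM.
  have -> : nceval x p * nceval x p' - b * c
      = (nceval x p - b) * nceval x p' + b * (nceval x p' - c).
    by rewrite mulrBl mulrBr addrA subrK.
  have p'c : cnorm (nceval x p') <= cnorm c + 1.
    have -> : nceval x p' = (nceval x p' - c) + c by rewrite subrK.
    apply: le_trans (cnormD _ _) _; rewrite addrC lerD2l (le_trans pc) //.
    by rewrite ge_min lexx.
  apply: le_trans (cnormD _ _) _.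
  have h1 := le_trans (cnormM _ _) (ler_pM (cnorm_ge0 _) (cnorm_ge0 _) pb p'c).
  have h2 :=
    le_trans (cnormM _ _) (ler_pM (cnorm_ge0 _) (cnorm_ge0 _) (lexx (cnorm b)) pc).
  apply: le_trans (lerD h1 h2) _.
  have : f * K <= d.
    by rewrite -ler_pdivlMr ?(lt_le_trans ltr01) // ge_min lexx orbT.
  rewrite /K; move: (cnorm b) (cnorm c) => t u; lra.
have subD : [set B : set A | is_csubalgebra B /\ B 1] D.
  split; last by have := constD 1; rewrite scale1r.
  split.
  - split=> [|b c bD cD d d0]; first by have := constD 0; rewrite scale0r.
    have d2 : 0 < d / 2 by rewrite divr_gt0.
    have [p [q [pq pb]]] := bD _ d2; have [p' [q' [pq' pc]]] := cD _ d2.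
    exists (p + p'), (q + q'); split; first exact: adjoint_pairD.
    rewrite ncevalD opprD addrACA; apply: le_trans (cnormD _ _) _.
    by apply: le_trans (lerD pb pc) _; rewrite -splitr.
  - by move=> c b bD; rewrite -mulr_algl; apply: mulD.
  - exact: mulD.
  - move=> b bD d d0; have [p [q [pq pb]]] := bD _ d0.
    exists q, p; split; first exact: adjoint_pair_sym.
    have [_ _ -> _] := pq.
    have -> : star (nceval x p) - star b = star (nceval x p - b).
      by rewrite starDr -[- b]scaleN1r starZr rmorphN1 scaleN1r.
    by rewrite cnorm_star.
  - move=> b bcl d d0; have d2 : 0 < d / 2 by rewrite divr_gt0.
    have [|c [cD cb]] := bcl (ball b (Complex (d / 2) 0)).
      by apply: nbhsx_ballx; rewrite ltcR.
    have [p [q [pq pc]]] := cD _ d2; exists p, q; split => //.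
    have cb' : cnorm (c - b) <= d / 2.
      move: cb; rewrite -ball_normE /= => /ltW; rewrite -cnormE lecR cnormB.
      exact.
    by apply: le_trans (cnorm_tri pc cb') _; rewrite -splitr.
apply/seteqP; split => // b _.
have : smallest [set B : set A | is_csubalgebra B /\ B 1] (range x) b by rewrite xgen.
suff: smallest [set B : set A | is_csubalgebra B /\ B 1] (range x) `<=` D by apply.
apply: smallest_sub => // _ [i _ <-] d d0.
exists (mkmalgU (fmu i) 1), (mkmalgU (fmu i) 1); split; first exact: adjoint_pair_var.
by rewrite nceval_var subrr cnorm0 ltW.
Qed.

End Density.

(** * Block structure of the microstates *)

Section PolynomialRelations.
Variables (R : realType) (n : nat) (B : algType R[i]) (x : 'I_n -> B).
Implicit Types p q r s : ncpoly R n.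

Definition rel_mul (b : bool) p q : ncpoly R n := p * q - mkmalgU mone b%:R * p.
Definition rel_copy (b : bool) p r s : ncpoly R n :=
  p * r * s * p - mkmalgU mone b%:R * p.
Definition rel_comm p q : ncpoly R n := p * q - q * p.

Lemma nceval_rel_mul b p q :
  nceval x (rel_mul b p q) = nceval x p * nceval x q - b%:R *: nceval x p.
Proof.
apply: etrans (ncevalB x _ _) _; congr (_ - _); first exact: ncevalM.
by apply: etrans (ncevalM x _ _) _; rewrite nceval_const mulr_algl.
Qed.

Lemma nceval_rel_copy b p r s : nceval x (rel_copy b p r s)
  = nceval x p * nceval x r * nceval x s * nceval x p - b%:R *: nceval x p.
Proof.
apply: etrans (ncevalB x _ _) _; congr (_ - _).
  do 2 (apply: etrans (ncevalM x _ _) _; congr (_ * _)).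
  exact: ncevalM.
by apply: etrans (ncevalM x _ _) _; rewrite nceval_const mulr_algl.
Qed.

Lemma nceval_rel_comm p q :
  nceval x (rel_comm p q) = nceval x p * nceval x q - nceval x q * nceval x p.
Proof. by apply: etrans (ncevalB x _ _) _; congr (_ - _); exact: ncevalM. Qed.

Lemma nceval_sum_sub1 (W : finType) (F : W -> ncpoly R n) :
  nceval x (\sum_w F w - mkmalgU mone 1) = \sum_w nceval x (F w) - 1.
Proof.
apply: etrans (ncevalB x _ _) _; congr (_ - _); first by rewrite /nceval raddf_sum.
by rewrite nceval_const scale1r.
Qed.

End PolynomialRelations.

Section Rationality.
Variables (R : realType) (n : nat).
Implicit Types p q r s : ncpoly R n.

Lemma rational_ncpolyB p q : rational_ncpoly R n p -> rational_ncpoly R n q ->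
  rational_ncpoly R n (p - q).
Proof.
move=> pr qr w; rewrite mcoeffB; apply: rational_scalarD => //.
by rewrite -mulN1r; apply: rational_scalarM => //; exact: rational_scalarN1.
Qed.

Lemma rational_rel_mul b p q : rational_ncpoly R n p -> rational_ncpoly R n q ->
  rational_ncpoly R n (rel_mul b p q).
Proof.
move=> pr qr; apply: rational_ncpolyB; apply: rational_ncpolyM => //.
exact/rational_monom/rational_scalar_nat.
Qed.

Lemma rational_rel_copy b p r s : rational_ncpoly R n p -> rational_ncpoly R n r ->
  rational_ncpoly R n s -> rational_ncpoly R n (rel_copy b p r s).
Proof.
move=> pr rr sr; apply: rational_ncpolyB; last first.
  by apply: rational_ncpolyM => //; exact/rational_monom/rational_scalar_nat.
by do 3 apply: rational_ncpolyM => //.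
Qed.

Lemma rational_rel_comm p q : rational_ncpoly R n p -> rational_ncpoly R n q ->
  rational_ncpoly R n (rel_comm p q).
Proof. by move=> pr qr; apply: rational_ncpolyB; apply: rational_ncpolyM. Qed.

Lemma rational_sum_sub1 (W : finType) (F : W -> ncpoly R n) :
  (forall w, rational_ncpoly R n (F w)) ->
    rational_ncpoly R n (\sum_w F w - mkmalgU mone 1).
Proof.
move=> Fr; apply: rational_ncpolyB; last exact/rational_monom/(rational_scalar_nat R 1).
apply: big_ind => [w||w _]; [|exact: rational_ncpolyD|exact: Fr].
by rewrite mcoeff0; exact: rational_scalar0.
Qed.

End Rationality.

Section PolynomialPartition.
Variables (R : realType) (A : cstarType R) (n : nat) (x : 'I_n -> A).

Lemma cnormM_near (a a' b b' : A) (ea eb na nb : R) :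
  cnorm (a' - a) <= ea -> cnorm (b' - b) <= eb -> cnorm a' <= na -> cnorm b <= nb ->
  cnorm (a' * b' - a * b) <= na * eb + ea * nb.
Proof.
move=> ha hb ha' hb'.
have -> : a' * b' - a * b = a' * (b' - b) + (a' - a) * b.
  by rewrite mulrBl mulrBr addrA subrK.
apply: le_trans (cnormD _ _) _; apply: lerD; apply: le_trans (cnormM _ _) _.
  by apply: ler_pM; rewrite ?cnorm_ge0.
by apply: ler_pM; rewrite ?cnorm_ge0.
Qed.

Lemma cnorm_near_le (a a' : A) (e c : R) : cnorm (a' - a) <= e -> cnorm a <= c ->
  cnorm a' <= c + e.
Proof.
move=> h1 h2; have -> : a' = (a' - a) + a by rewrite subrK.
by apply: le_trans (cnormD _ _) _; rewrite addrC lerD.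
Qed.

Lemma cnormM_bound (a b : A) na nb : cnorm a <= na -> cnorm b <= nb ->
  cnorm (a * b) <= na * nb.
Proof.
by move=> ha hb; apply: le_trans (cnormM _ _) _; apply: ler_pM; rewrite ?cnorm_ge0.
Qed.

Lemma cnorm_rel_near (a a' b b' : A) e1 e2 e3 : cnorm (a - b) <= e1 ->
  cnorm (a' - a) <= e2 -> cnorm (b' - b) <= e3 -> cnorm (a' - b') <= e2 + (e1 + e3).
Proof.
move=> h1 h2 h3; apply: cnorm_tri h2 _; apply: cnorm_tri h1 _.
by rewrite cnormB.
Qed.

(** By density and continuity, the relations of an almost central partition
    survive when its members are replaced by rational polynomials in the
    generators; each relation then is the norm of a rational polynomial, to
    which the definition of microstates applies. *)
Lemma polynomial_partition t (h : R) : approximately_divisible A ->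
  (forall i, star (x i) = x i) -> generated_by x -> 0 < h ->
  exists (gp gp' : piece t -> ncpoly R n) (rp sp : copy t -> ncpoly R n),
  [/\ [/\ forall w, adjoint_pair x (gp w) (gp' w),
        forall u, rational_ncpoly R n (rp u) & forall u, rational_ncpoly R n (sp u)],
      [/\ forall w, cnorm (nceval x (gp w)) <= 3 / 2, forall u,
        cnorm (nceval x (rp u)) <= 3 / 2
        & forall u, cnorm (nceval x (sp u)) <= 3 / 2],
      cnorm (nceval x (\sum_w gp w - mkmalgU mone 1)) <= h /\
      (forall w w', cnorm (nceval x (rel_mul (w == w') (gp w) (gp w'))) <= h),
      forall w, cnorm (nceval x (gp' w - gp w)) <= h
    & (forall w u u', cnorm (nceval x (rel_copy (u == u') (gp w) (rp u) (sp u')))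
      <= h) /\
      (forall w i, cnorm (nceval x (rel_comm (gp w) (mkmalgU (fmu i) 1))) <= h)].
Proof.
move=> Adiv x_sa xgen h0.
have h20 : 0 < h / 2 by rewrite divr_gt0.
have [g [r [s [gsum [g1 r1 s1] gg gstar [grs gF]]]]] :=
  exists_almost_central_partition t (codom x) Adiv h20.
pose c := \sum_i cnorm (x i).
have xc i : cnorm (x i) <= c.
  by rewrite /c (bigD1 i) //= lerDl sumr_ge0 // => j _; exact: cnorm_ge0.
have c0 : 0 <= c by rewrite sumr_ge0 // => i _; exact: cnorm_ge0.
(* An error [z] on each member costs at most 32 z, 2 c z and [#|piece t|] z in
   the relations on copies, on commutators and on the sum. *)
pose D := 32 + 2 * c + #|piece t|%:R.
have D0 : 0 < D by rewrite ltr_wpDr // ltr_wpDr // mulr_ge0.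
have [z [z0 z12 zD]] : exists z, [/\ 0 < z, z <= 1 / 2 & z * D <= h / 2].
  exists (Num.min (1 / 2) (h / 2 / D)); split.
  - by rewrite lt_min !divr_gt0.
  - by rewrite ge_min lexx.
  - by rewrite -ler_pdivlMr // ge_min lexx orbT.
have zD1 : z * 32 <= h / 2 by apply: le_trans zD;
  rewrite ler_pM2l // /D -addrA lerDl addr_ge0 // mulr_ge0.
have zD2 : z * (2 * c) <= h / 2.
  by apply: le_trans zD; rewrite ler_pM2l // /D addrAC lerDr addr_ge0.
have zD3 : z * #|piece t|%:R <= h / 2.
  by apply: le_trans zD; rewrite ler_pM2l // /D lerDr addr_ge0 // mulr_ge0.
have /choice[gq gqP] : forall w, exists pq,
  adjoint_pair x pq.1 pq.2 /\ cnorm (nceval x pq.1 - g w) <= z.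
  by move=> w; have [p [q pqP]] := rational_polys_dense x_sa (g w) xgen z0;
    exists (p, q).
have /choice[rp rpP] : forall u, exists p,
  rational_ncpoly R n p /\ cnorm (nceval x p - r u) <= z.
  by move=> u; have [p [q [[pr _ _ _] pz]]] :=
    rational_polys_dense x_sa (r u) xgen z0; exists p.
have /choice[sp spP] : forall u, exists p,
  rational_ncpoly R n p /\ cnorm (nceval x p - s u) <= z.
  by move=> u; have [p [q [[pr _ _ _] pz]]] :=
    rational_polys_dense x_sa (s u) xgen z0; exists p.
have gz w := (gqP w).2; have rz u := (rpP u).2; have sz u := (spP u).2.
have le32 (a a' : A) : cnorm (a' - a) <= z -> cnorm a <= 1 -> cnorm a' <= 3 / 2.
  move=> h1 h2; apply: le_trans (cnorm_near_le h1 h2) _; clear -z12; lra.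
have g32 w := le32 _ _ (gz w) (g1 w); have r32 u := le32 _ _ (rz u) (r1 u).
have s32 u := le32 _ _ (sz u) (s1 u).
have dz (b : bool) w : cnorm (b%:R *: nceval x (gq w).1 - b%:R *: g w) <= z.
  rewrite -scalerBr; case: b; rewrite ?scale1r // scale0r cnorm0; exact: ltW.
exists (fun w => (gq w).1), (fun w => (gq w).2), rp, sp; split.
- split=> [w|u|u]; [exact: (gqP w).1|exact: (rpP u).1|exact: (spP u).1].
- by split.
- split=> [|w w'].
  + apply: (le_trans _ (_ : h / 2 <= h)); last by clear -h0; lra.
    rewrite nceval_sum_sub1 -gsum -sumrB; apply: le_trans zD3.
    have : cnorm (\sum_w (nceval x (gq w).1 - g w))
      <= \sum_w cnorm (nceval x (gq w).1 - g w).
      elim/big_ind2 : _ => [|u u' v v' h1 h2|//]; first by rewrite cnorm0.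
      exact: le_trans (cnormD _ _) (lerD h1 h2).
    move=> /le_trans; apply; rewrite mulr_natr -sumr_const; apply: ler_sum => w _;
      exact: gz.
  + rewrite nceval_rel_mul.
    have h1 := cnormM_near (gz w) (gz w') (g32 w) (g1 w').
    apply: le_trans (cnorm_rel_near (gg w w') h1 (dz _ w)) _.
    by clear -zD1 z0; lra.
- move=> w; have [[_ _ gE _] _] := gqP w.
  rewrite ncevalB gE.
  have h1 : cnorm (star (nceval x (gq w).1) - star (g w)) <= z.
    by rewrite -[- star _]scaleN1r -(rmorphN1 (@Num.conj R[i])) -starZr scaleN1r
      -starDr cnorm_star.
  apply: le_trans (cnorm_rel_near (gstar w) h1 (gz w)) _.
  by clear -zD1 z0; lra.
- split=> [w u u'|w i].
  + rewrite nceval_rel_copy.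
    have h1 := cnormM_near (gz w) (rz u) (g32 w) (r1 u).
    have n1 := cnormM_bound (g32 w) (r32 u).
    have h2 := cnormM_near h1 (sz u') n1 (s1 u').
    have n2 := cnormM_bound n1 (s32 u').
    have h3 := cnormM_near h2 (gz w) n2 (g1 w).
    apply: le_trans (cnorm_rel_near (grs w u u') h3 (dz _ w)) _.
    by clear -zD1 z0; lra.
  + rewrite nceval_rel_comm nceval_var.
    have xx : cnorm (x i - x i) <= 0 by rewrite subrr cnorm0.
    have h1 := cnormM_near (gz w) xx (g32 w) (xc i).
    have h2 := cnormM_near xx (gz w) (xc i) (g1 w).
    have gx : cnorm (g w * x i - x i * g w) <= h / 2.
      by rewrite cnormB; apply: gF; exact: codom_f.
    apply: le_trans (cnorm_rel_near gx h1 h2) _.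
    by clear -zD2 z0; lra.
Qed.

End PolynomialPartition.

Lemma microstate_norm_le (R : realType) (A : cstarType R) (n : nat) (x : 'I_n -> A)
    (p : nat -> ncpoly R n) (q : ncpoly R n) :
  range p = rational_ncpoly R n ->
  rational_ncpoly R n q ->
  \forall m \near \oo, forall e k (M : 'I_n -> 'M[R[i]]_k.+1), Gamma_top p x k e m M ->
    opnorm (nceval M q) <= cnorm (nceval x q) + e.
Proof.
move=> <- -[j _ <-]; exists j.+1 => // m /= jm e k M [_ MG].
by have /ltW := MG _ jm; rewrite ler_norml => /andP[_]; rewrite lerBlDl.
Qed.

Lemma microstate_norms_le (R : realType) (A : cstarType R) (n : nat) (x : 'I_n -> A)
    (p : nat -> ncpoly R n) (I : finType) (q : I -> ncpoly R n) :
  range p = rational_ncpoly R n ->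
  (forall i, rational_ncpoly R n (q i)) ->
  \forall m \near \oo, forall e k (M : 'I_n -> 'M[R[i]]_k.+1), Gamma_top p x k e m M ->
    forall i, opnorm (nceval M (q i)) <= cnorm (nceval x (q i)) + e.
Proof.
move=> p_enum qr; apply: (filterS _ (@filter_forall nat I (fun i m =>
    forall e k (M : 'I_n -> 'M[R[i]]_k.+1), Gamma_top p x k e m M ->
    opnorm (nceval M (q i)) <= cnorm (nceval x (q i)) + e) \oo _ _)).
  by move=> m mP e k M MG i; exact: mP.
by move=> i; exact: (microstate_norm_le x p_enum).
Qed.

Lemma Gamma_top_herm (R : realType) (A : cstarType R) (n : nat) (x : 'I_n -> A)
    (p : nat -> ncpoly R n) k e m (M : 'I_n -> 'M[R[i]]_k.+1) i :
  Gamma_top p x k e m M -> adj (M i) = M i.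
Proof. by move=> [/(_ i)/is_hermitianmxP]; rewrite expr0 scale1r => <-. Qed.

Lemma mulmx_replace (R : realType) k (P G r s : 'M[R[i]]_k) (b : R[i]) :
  P *m r *m s *m P - b *: P = (P - G) *m r *m s *m P + (G *m r *m s *m (P - G)
    + (G *m r *m s *m G - b *: G) - b *: (P - G)).
Proof.
have zmod_id (V : zmodType) (a1 b1 c1 d1 e1 : V) :
    a1 - e1 = (a1 - b1) + ((b1 - c1) + (c1 - d1) - (e1 - d1)).
  by rewrite (addrA (b1 - c1)) subrK opprB (addrA (b1 - d1)) subrK addrA subrK.
by rewrite !mulmxBl mulmxBr scalerBr; exact: zmod_id.
Qed.

(** The relations of polynomial_partition hold in a microstate up to [h], so
    that its matrices [gp w] are close to block projections, which have small
    rank and almost commute with the microstate. *)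
Lemma microstate_blocks (R : realType) (A : cstarType R) (n : nat) (x : 'I_n -> A)
    (p : nat -> ncpoly R n) t (tau : R) : range p = rational_ncpoly R n ->
  approximately_divisible A ->
  (forall i, star (x i) = x i) -> generated_by x -> 0 < tau -> tau <= 1 ->
  exists (e : R) (m : nat), [/\ 0 < e, (0 < m)%N &
    forall k (M : 'I_n -> 'M[R[i]]_k.+1), Gamma_top p x k e m M ->
    exists (U : 'M[R[i]]_k.+1) (d : 'I_k.+1 -> piece t) (Y : 'I_n -> 'M[R[i]]_k.+1),
    [/\ adj U *m U = 1%:M /\ U *m adj U = 1%:M,
        forall w, (2 ^ t * #|[pred a | d a == w]| <= k.+1)%N,
        forall i a b, d a != d b -> Y i a b = 0,
        forall i, opnorm (M i - U *m Y i *m adj U) <= tau &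
        forall i, opnorm (Y i) <= \sum_i cnorm (x i) + 2]].
Proof.
move=> p_enum Adiv x_sa xgen tau0 tau1.
have [K K0 KP] := almost_partition_of_unity R (piece t).
pose c := \sum_i cnorm (x i) + 1.
have c0 : 0 <= c by rewrite addr_ge0 // sumr_ge0 // => i _; exact: cnorm_ge0.
pose a1 := (13 * K + 1) * (2 ^ t)%:R.
pose b1 := #|piece t|%:R * (2 * c * K + 1).
have a10 : 0 <= a1 by rewrite mulr_ge0 // addr_ge0 // mulr_ge0 // ltW.
have b10 : 0 <= b1 by rewrite mulr_ge0 // addr_ge0 // !mulr_ge0 // ltW.
(* [ha] bounds the error on the copies, for the rank estimate, and [hb] the
   error of the block compression. *)
have [h [h0 h4 ha hb]] : exists h, [/\ 0 < h, h <= 1 / 4, h * a1 < 1 & h * b1 <= tau].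
  exists (Num.min (1 / 4) (Num.min (1 / (a1 + 1)) (tau / (b1 + 1)))).
  have a2 : 0 < a1 + 1 by rewrite ltr_wpDl.
  have b2 : 0 < b1 + 1 by rewrite ltr_wpDl.
  set h := Num.min _ _.
  have h0 : 0 < h by rewrite !lt_min !divr_gt0.
  have ha : h * (a1 + 1) <= 1 by rewrite -ler_pdivlMr // !ge_min lexx orbT.
  have hb : h * (b1 + 1) <= tau by rewrite -ler_pdivlMr // !ge_min lexx !orbT.
  split => //; first by rewrite ge_min lexx.
  - by move: ha; rewrite mulrDr mulr1; clear -h0; lra.
  - by move: hb; rewrite mulrDr mulr1; clear -h0; lra.
have h20 : 0 < h / 2 by rewrite divr_gt0.
have [gp [gp'
  [rp [sp [[gadj rr sr] [g32 r32 s32] [gsum gmul] gstar [gcopy gcomm]]]]]] :=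
  polynomial_partition t Adiv x_sa xgen h20.
have gr w : rational_ncpoly R n (gp w) by have [] := gadj w.
have gr' w : rational_ncpoly R n (gp' w) by have [] := gadj w.
have xr i : rational_ncpoly R n (mkmalgU (fmu i) 1)
  by exact/rational_monom/(rational_scalar_nat R 1).
have [m [m0 mP]] : exists m, (0 < m)%N /\ forall k (M : 'I_n -> 'M[R[i]]_k.+1),
  Gamma_top p x k (h / 2) m M ->
  [/\ [/\ forall w, opnorm (nceval M (gp w)) <= 2, forall u,
    opnorm (nceval M (rp u)) <= 2,
          forall u, opnorm (nceval M (sp u)) <= 2 & forall i, opnorm (M i) <= c],
      opnorm (nceval M (\sum_w gp w - mkmalgU mone 1)) <= h /\
      (forall w w', opnorm (nceval M (rel_mul (w == w') (gp w) (gp w'))) <= h),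
      forall w, opnorm (nceval M (gp' w - gp w)) <= h
    & (forall w u u', opnorm (nceval M (rel_copy (u == u') (gp w) (rp u) (sp u')))
      <= h) /\
      (forall w i, opnorm (nceval M (rel_comm (gp w) (mkmalgU (fmu i) 1))) <= h)].
  have N1 := microstate_norms_le x p_enum gr;
    have N2 := microstate_norms_le x p_enum rr.
  have N3 := microstate_norms_le x p_enum sr;
    have N4 := microstate_norms_le x p_enum xr.
  have N5 := microstate_norm_le x p_enum (rational_sum_sub1 gr).
  have N6 := microstate_norms_le x p_enum (fun ww : piece t * piece t =>
    rational_rel_mul (ww.1 == ww.2) (gr ww.1) (gr ww.2)).
  have N7 := microstate_norms_le x p_enum (fun w => rational_ncpolyB (gr' w) (gr w)).
  have N8 := microstate_norms_le x p_enum (fun wu : piece t * (copy t * copy t) =>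
    rational_rel_copy (wu.2.1 == wu.2.2) (gr wu.1) (rr wu.2.1) (sr wu.2.2)).
  have N9 :=
    microstate_norms_le x p_enum (fun wi :
    piece t * 'I_n => rational_rel_comm (gr wi.1) (xr wi.2)).
  have [m [Q1 [Q2 [Q3 [Q4 [Q5 [Q6 [Q7 [Q8 [Q9 m0]]]]]]]]]] := @filter_ex _ \oo _ _
    (filterI N1 (filterI N2 (filterI N3 (filterI N4 (filterI N5 (filterI N6
    (filterI N7 (filterI N8 (filterI N9 (nbhs_infty_gt 0)))))))))).
  exists m; split=> // k M MG.
  have half (u v : R) : u <= v + h / 2 -> v <= h / 2 -> u <= h by clear; lra.
  have hh : h / 2 <= 1 by clear -h4; lra.
  have two (u v : R) : u <= v + h / 2 -> v <= 3 / 2 -> u <= 2 by clear -h4; lra.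
  have P1 := Q1 _ k M MG; have P2 := Q2 _ k M MG; have P3 := Q3 _ k M MG.
  have P4 := Q4 _ k M MG; have P5 := Q5 _ k M MG; have P6 := Q6 _ k M MG.
  have P7 := Q7 _ k M MG; have P8 := Q8 _ k M MG; have P9 := Q9 _ k M MG.
  split; [split|split| |split].
  - by move=> w; exact: two (P1 w) (g32 w).
  - by move=> u; exact: two (P2 u) (r32 u).
  - by move=> u; exact: two (P3 u) (s32 u).
  - move=> i; have := P4 i; rewrite !nceval_var => /le_trans; apply.
    rewrite /c (bigD1 i) //= -addrA lerD2l; apply: ler_wpDl hh;
      by rewrite sumr_ge0 // => j _; exact: cnorm_ge0.
  - exact: half P5 gsum.
  - by move=> w w'; exact: half (P6 (w, w')) (gmul w w').
  - by move=> w; exact: half (P7 w) (gstar w).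
  - by move=> w u u'; exact: half (P8 (w, (u, u'))) (gcopy w u u').
  - by move=> w i; exact: half (P9 (w, i)) (gcomm w i).
exists (h / 2), m; split => // k M MG;
  have [[G2 r2 s2 Mc] [Gsum Gmul] Gstar [Gcopy Gcomm]] := mP k M MG.
have Mh i : adj (M i) = M i by exact: Gamma_top_herm MG.
pose G w := nceval M (gp w).
have GG w w' : opnorm (G w *m G w' - (w == w')%:R *: G w) <= h.
  by have := Gmul w w'; rewrite nceval_rel_mul.
have Gadj w : opnorm (adj (G w) - G w) <= h.
  have [_ _ _ gM] := gadj w.
  by have := Gstar w; rewrite ncevalB (gM k M Mh).
have Gsum1 : opnorm (\sum_w G w - 1%:M) <= h.
  by have := Gsum; rewrite nceval_sum_sub1.
have [U [d [UU UU' GP]]] := KP _ G h (ltW h0) h4 G2 GG Gadj Gsum1.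
have Kh0 : 0 <= K * h by rewrite mulr_ge0 // ltW.
have GM w i : opnorm (G w *m M i - M i *m G w) <= h.
  by have := Gcomm w i; rewrite nceval_rel_comm nceval_var.
have /choice[Y YP] i := block_compression UU UU' (Mc i) c0 GP (fun w => GM w i).
have small : #|piece t|%:R * (2 * c * (K * h) + h) <= tau.
  by apply: le_trans hb; rewrite /b1; clear; lra.
exists U, d, Y; split.
- by split.
- move=> w; rewrite -card_copy.
  apply: (@block_size_le _ _ _ _ U d w (fun u => nceval M (rp u))
    (fun u => nceval M (sp u)) (h * (13 * K + 1))) => //.
    by rewrite card_copy -mulrA.
  move=> u u'; set P := block_proj U d w; set r := nceval M (rp u);
    set s := nceval M (sp u').
  have PG : opnorm (P - G w) <= K * h by rewrite opnormB; exact: GP.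
  have P1 : opnorm P <= 1 by exact: opnorm_block_proj.
  have GrsG : opnorm (G w *m r *m s *m G w - (u == u')%:R *: G w) <= h.
    by have := Gcopy w u u'; rewrite nceval_rel_copy.
  rewrite (mulmx_replace P (G w)).
  have h1 := opnormM_le (opnormM_le (opnormM_le PG (r2 u)) (s2 u')) P1.
  have h2 := opnormM_le (opnormM_le (opnormM_le (G2 w) (r2 u)) (s2 u')) PG.
  have h3 : opnorm ((u == u')%:R *: (P - G w)) <= K * h.
    case: (u == u'); first by rewrite scale1r; exact: PG.
    by rewrite scale0r opnorm0.
  apply: le_trans (opnormD _ _) _; apply: le_trans (lerD h1 (opnormD _ _)) _.
  rewrite opnormN; apply: le_trans (lerD (lexx _) (lerD (opnormD _ _) h3)) _.
  apply: le_trans (lerD (lexx _) (lerD (lerD h2 GrsG) (lexx _))) _.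
  by clear; lra.
- by move=> i; have [] := YP i.
- by move=> i; have [_ /le_trans + _] := YP i; apply.
- move=> i; have [_ _ /le_trans] := YP i; apply; rewrite /c.
  by move: small; rewrite /c; move: (_ * (_ + h)) => u uh; clear -uh tau1; lra.
Qed.

(** * Counting: covering numbers of microstates and the entropy dimension *)

Lemma card_piece t : #|piece t| = (3 ^ t)%N.
Proof. by elim: t => [|t IHt];
  rewrite /= ?card_unit // card_prod IHt card_ord expnSr. Qed.

(** Every row meets the diagonal blocks in at most [k / N] positions. *)
Lemma card_block_pos (W : finType) k N (d : 'I_k -> W) :
  (forall w, N * #|[pred a | d a == w]| <= k)%N ->
  (N * #|[pred ab : 'I_k * 'I_k | d ab.1 == d ab.2]| <= k * k)%N.
Proof.
move=> dN.
have -> : #|[pred ab : 'I_k * 'I_k | d ab.1 == d ab.2]|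
  = (\sum_(b < k) #|[pred a | d a == d b]|)%N.
  rewrite -sum1_card big_mkcond /=.
  rewrite -(pair_bigA _ (fun a b : 'I_k => if d a == d b then 1 else 0)%N) /=.
  by rewrite exchange_big /=; apply: eq_bigr => b _; rewrite -sum1_card [RHS]big_mkcond.
have -> : (k * k = \sum_(b < k) k)%N by rewrite sum_nat_const card_ord.
by rewrite big_distrr /=; apply: leq_sum => b _; exact: dN.
Qed.

(** Only differences of unitaries need be estimated, as
    [U^* - V^* = U^* (V - U) V^*]. *)
Lemma conj_distance (R : realType) k (U V Y Z : 'M[R[i]]_k) (a b : R) :
  adj U *m U = 1%:M -> adj V *m V = 1%:M -> opnorm Y <= 1 -> opnorm Z <= 1 ->
  opnorm (U - V) <= a -> opnorm (Y - Z) <= b ->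
  opnorm (U *m Y *m adj U - V *m Z *m adj V) <= 2 * a + b.
Proof.
move=> UU VV Y1 Z1 UV YZ.
have UU' : U *m adj U = 1%:M by exact: mulmx1C.
have VV' : V *m adj V = 1%:M by exact: mulmx1C.
have aU : opnorm (adj U) <= 1 by apply: opnorm_isometry; rewrite adjK.
have aV : opnorm (adj V) <= 1 by apply: opnorm_isometry; rewrite adjK.
have V1 := opnorm_isometry VV.
have UVa : opnorm (adj U - adj V) <= a.
  have -> : adj U - adj V = adj U *m (V - U) *m adj V.
    by rewrite mulmxBr mulmxBl UU mul1mx -mulmxA VV' mulmx1.
  rewrite -[leRHS]mulr1 -[X in X * 1]mul1r; apply: opnormM_le aV.
  by apply: opnormM_le aU _; rewrite opnormB.
have zmod_tele (T : zmodType) (a1 b1 c1 e1 : T) :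
    a1 - e1 = (a1 - b1) + ((b1 - c1) + (c1 - e1)).
  by rewrite (addrA (b1 - c1)) subrK addrA subrK.
have -> : U *m Y *m adj U - V *m Z *m adj V = (U - V) *m Y *m adj U
    + (V *m (Y - Z) *m adj U + V *m Z *m (adj U - adj V)).
  rewrite !mulmxBr !mulmxBl; exact: zmod_tele.
have h1 := opnormM_le (opnormM_le UV Y1) aU.
have h2 := opnormM_le (opnormM_le V1 YZ) aU.
have h3 := opnormM_le (opnormM_le V1 Z1) UVa.
apply: le_trans (opnormD _ _) _; apply: le_trans (lerD h1 (opnormD _ _)) _.
apply: le_trans (lerD (lexx _) (lerD h2 h3)) _.
by clear; lra.
Qed.

(** The number of real parameters of a model with blocks of size at most
    [k / 2 ^ t]: a Hermitian matrix and [n] block diagonal complex matrices. *)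
Definition net_exponent n t k : nat := (k * k + (2 * n * (k * k)) %/ 2 ^ t)%N.

(** The first factor counts the block patterns, the second one bounds the net of
    the parameters for each of them.  The bound [50 * c] on the scale makes
    the reconstruction of the microstate Lipschitz enough: an error [f] on the
    parameters costs [25 * c * f = w / 2], added to the error [w / 4] of the
    block model. *)
Lemma covering_number_microstates (R : realType) (A : cstarType R) (n : nat)
    (x : 'I_n -> A) (p : nat -> ncpoly R n) t (w : R) (N : nat) :
  let c := \sum_i cnorm (x i) + 2 in
  range p = rational_ncpoly R n -> approximately_divisible A ->
  (forall i, star (x i) = x i) -> generated_by x -> 0 < w -> w < 1 ->
  6 / (w / (50 * c)) <= N%:R ->
  exists (e : R) (m : nat), [/\ 0 < e, (0 < m)%N & forall k,
    (covering_number (Gamma_top p x k e m) w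
      <= ((#|piece t| ^ k.+1 * N ^ net_exponent n t k.+1)%:R)%:E)%E].
Proof.
move=> c p_enum Adiv x_sa xgen w0 w1 wN.
have c2 : 2 <= c by rewrite /c lerDr sumr_ge0 // => i _; exact: cnorm_ge0.
have c0 : 0 < c by clear -c2; lra.
have w40 : 0 < w / 4 by rewrite divr_gt0.
have w41 : w / 4 <= 1 by clear -w1; lra.
have [e [m [e0 m0 emP]]] := microstate_blocks t p_enum Adiv x_sa xgen w40 w41.
exists e, m; split => // k.
pose f := w / (50 * c).
have f0 : 0 < f by rewrite divr_gt0 // mulr_gt0.
have f1 : f <= 1 by rewrite ler_pdivrMr ?mulr_gt0 // mul1r; clear -w1 c2; lra.
have f01 : 0 < f <= 1 by rewrite f0.
have cf : c * f = w / 50 by rewrite /f; field; rewrite gt_eqF.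
have N0 : (0 < N)%N.
  by rewrite -(ltr0n R); apply: lt_le_trans wN; rewrite divr_gt0.
pose k1 := k.+1.
(* The pairs made of a Hermitian parameter of the unitary and of the diagonal
   blocks, rescaled to be contractions. *)
pose S (d : 'I_k1 -> piece t) : set ('M[R[i]]_k1 * ('I_n -> 'M[R[i]]_k1)) :=
  [set HY : 'M[R[i]]_k1 * ('I_n -> 'M[R[i]]_k1) | [/\ adj HY.1 = HY.1
    /\ adj (cayley_sqr HY.1) *m cayley_sqr HY.1 = 1%:M,
     opnorm HY.1 <= 1, forall i a b, d a != d b -> HY.2 i a b = 0 & forall i,
       opnorm (HY.2 i) <= 1]].
pose is_net (d : 'I_k1 -> piece t) (q : nat) (z : 'I_q ->
  'M[R[i]]_k1 * ('I_n -> 'M[R[i]]_k1)) : Prop :=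
    [/\ (q <= N ^ net_exponent n t k1)%N, forall j, S d (z j) &
    (forall v, 2 ^ t * #|[pred a | d a == v]| <= k1)%N -> forall HY, S d HY ->
      exists j, opnorm (HY.1 - (z j).1) <= f /\ forall i,
        opnorm (HY.2 i - (z j).2 i) <= f].
have net (d : 'I_k1 -> piece t) : exists (q : nat) z, is_net d q z.
  (* A pattern with too large a block does not occur: it needs no centre. *)
  have [dk|dk] := pselect (forall v, 2 ^ t * #|[pred a | d a == v]| <= k1)%N;
    last first.
    by exists 0%N, (fun=> (0, fun=> 0)); split => // -[] [].
  have [|q [z [qN zS zP]]] := @block_model_net R _ k1 n d f N (S d) f01 wN.
    by move=> HY [[]].
  exists q, z; split => //; apply: leq_trans qN _; rewrite leq_pexp2l // leq_add2l.
  rewrite leq_divRL ?expn_gt0 // mulnAC -mulnA leq_mul2l mulnC.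
  by rewrite card_block_pos ?orbT.
have [q [z zP]] : exists (q : ('I_k1 -> piece t) -> nat)
    (z : forall d, 'I_(q d) -> 'M[R[i]]_k1 * ('I_n -> 'M[R[i]]_k1)), forall d,
      is_net d (q d) (z d).
  exists (fun d => projT1 (cid (net d))),
    (fun d => projT1 (cid (projT2 (cid (net d))))) => d.
  exact: projT2 (cid (projT2 (cid (net d)))).
pose T : finType := ({ffun 'I_k1 -> piece t} * 'I_(N ^ net_exponent n t k1))%type.
pose model (HY : 'M[R[i]]_k1 * ('I_n -> 'M[R[i]]_k1)) (i : 'I_n) : 'M[R[i]]_k1 :=
  real_complex R c *: (cayley_sqr HY.1 *m HY.2 i *m adj (cayley_sqr HY.1)).
pose center (dj : T) : 'I_n -> 'M[R[i]]_k1 :=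
  if insub (dj.2 : nat) :
    option 'I_(q dj.1) is Some j then model (z dj.1 j) else fun=> 0.
apply: ereal_inf_lbound => /=; exists #|T|; last first.
  by rewrite card_prod card_ffun !card_ord.
exists (fun u => center (enum_val u)) => M MG.
have [U [d [Y [[UU UU'] dk Y0 MY Yc]]]] := emP k M MG.
have [H [Hh H1 HU]] := unitary_cayley_sqr UU UU'.
pose d' : {ffun 'I_k1 -> piece t} := [ffun a => d a].
have dd' : (d' : 'I_k1 -> piece t) = d by apply/funext => a; rewrite ffunE.
pose Y' i := real_complex R c^-1 *: Y i.
have S_HY : S d' (H, Y').
  rewrite dd'; split; [split => //=|exact: H1| |].
  - by rewrite HU.
  - by move=> i a b dab; rewrite mxE Y0 // mulr0.
  - move=> i /=; rewrite opnormZR gtr0_norm ?invr_gt0 //.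
    by rewrite ler_pdivrMl // mulr1.
have [qN zS zC] := zP d'.
have [j [jH jY]] : exists j, opnorm (H - (z d' j).1) <= f /\ forall i,
  opnorm (Y' i - (z d' j).2 i) <= f.
  by apply: (zC _ (H, Y')) => //; rewrite dd'.
pose u : 'I_#|T| := enum_rank ((d', widen_ord qN j) : T).
exists u => //=; rewrite enum_rankK /center /=.
rewrite (_ : insub _ = Some j); last by rewrite -[RHS]valK.
apply: bigmax_lt => // i _; set X := model _ i.
have [[zh zU] z1 _ zY1] := zS j.
have -> : M i - X = (M i - U *m Y i *m adj U) + (U *m Y i *m adj U - X)
  by rewrite addrA subrK.
have -> : U *m Y i *m adj U - X = real_complex R c *:
   (cayley_sqr H *m Y' i *m adj (cayley_sqr H)
    - cayley_sqr (z d' j).1 *m (z d' j).2 i *m adj (cayley_sqr (z d' j).1)).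
  rewrite scalerBr; congr (_ - _);
    rewrite HU /Y' -scalemxAr -scalemxAl scalerA -rmorphM.
  by rewrite mulfV ?gt_eqF // rmorph1 scale1r.
have [_ _ _ Y'1] := S_HY.
have HUU : adj (cayley_sqr H) *m cayley_sqr H = 1%:M by rewrite HU.
have H12 : opnorm (cayley_sqr H - cayley_sqr (z d' j).1) <= 12 * f.
  apply: le_trans (cayley_sqr_lipschitz Hh zh) _.
  by have := ler_wpM2l (ler0n R 12) jH.
have := conj_distance HUU zU (Y'1 i) (zY1 i) H12 (jY i).
set Q := _ - _ => Qf.
apply: (@le_lt_trans _ _ (w / 4 + c * (2 * (12 * f) + f))).
  apply: le_trans (opnormD _ _) _; apply: lerD; first exact: MY.
  by rewrite opnormZR (gtr0_norm c0); exact: ler_wpM2l (ltW c0) _ _ Qf.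
by move: cf; clear -w0; lra.
Qed.

Lemma limf_esup_le (R : realType) (T : choiceType) (X : filteredType T) (f : X ->
  \bar R)
    (F : set_system X) (l : \bar R) : (\forall x \near F, (f x <= l)%E) ->
      (limf_esup f F <= l)%E.
Proof.
move=> fl; rewrite limf_esupE;
  apply: (@le_trans _ _ (ereal_sup (f @` [set x | (f x <= l)%E]))).
  by apply: ereal_inf_lbound; exists [set x | (f x <= l)%E].
by apply: ge_ereal_sup => _ [x /= ? <-].
Qed.

Lemma covering_number_ge0 (R : realType) n k (F : set ('I_n -> 'M[R[i]]_k)) (w : R) :
  (0 <= covering_number F w)%E.
Proof. by apply: le_ereal_inf_tmp => _ [N _ <-]; rewrite lee_fin. Qed.

Lemma net_exponent_le (R : realType) n t k :
  (net_exponent n t k)%:R <= k%:R ^+ 2 * (1 + (2 * n)%:R / (2 ^ t)%:R) :> R.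
Proof.
rewrite natrD natrM -expr2 mulrDr mulr1 lerD2l mulrA ler_pdivlMr ?ltr0n ?expn_gt0 //.
by rewrite -natrX -!natrM ler_nat mulnC mulnn mulnC [leqRHS]mulnC leq_divM.
Qed.

(** The number of block patterns has a logarithm linear in [k], which vanishes
    against [k ^ 2]. *)
Lemma delta_top_at_le (R : realType) (A : cstarType R) (n : nat)
    (x : 'I_n -> A) (p : nat -> ncpoly R n) t (w : R) (N : nat) :
  let c := \sum_i cnorm (x i) + 2 in
  range p = rational_ncpoly R n -> approximately_divisible A ->
  (forall i, star (x i) = x i) -> generated_by x -> 0 < w -> w < 1 ->
  6 / (w / (50 * c)) <= N%:R ->
  (delta_top_at p x w <= ((1 + (2 * n)%:R / (2 ^ t)%:R) * ln N%:R / - ln w)%:E)%E.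
Proof.
move=> c p_enum Adiv x_sa xgen w0 w1 wN.
have [e [m [e0 m0 cov]]] :=
  covering_number_microstates t p_enum Adiv x_sa xgen w0 w1 wN.
have c0 : 0 < c.
  by rewrite ltr_wpDl // sumr_ge0 // => i _; exact: cnorm_ge0.
have N0 : 0 < N%:R :> R by apply: lt_le_trans wN; rewrite !divr_gt0 // mulr_gt0.
have lnw : 0 < - ln w by rewrite oppr_gt0 ln_lt0 // w0.
set b := _ * ln _ / _.
apply: (@le_trans _ _ (limn_esup (fun k : nat =>
  (lne (covering_number (Gamma_top p x k e m) w) *
    ((- (k.+1%:R ^+ 2 * ln w))^-1)%:E)%E))).
  by apply: ereal_inf_lbound; exists (e, m).
apply/lee_addgt0Pr => th th0; rewrite -EFinD.
apply: limf_esup_le.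
pose L : R := (#|piece t|)%:R.
have L1 : 1 <= L by rewrite ler1n card_piece expn_gt0.
have lnL : 0 <= ln L by exact: ln_ge0.
near=> k.
have k0 : 0 < k.+1%:R :> R by [].
have kth : ln L / (k.+1%:R * - ln w) <= th.
  rewrite ler_pdivrMr ?mulr_gt0 // mulrCA -ler_pdivrMr ?mulr_gt0 //.
  apply: le_trans (_ : k%:R <= _); last by rewrite ler_nat.
  by near: k; exact: nbhs_infty_ger.
have den0 : 0 < - (k.+1%:R ^+ 2 * ln w) by rewrite -mulrN mulr_gt0 // exprn_gt0.
have cov0 := covering_number_ge0 (Gamma_top p x k e m) w.
pose E := net_exponent n t k.+1.
have lnN0 : 0 <= ln N%:R :> R by apply: ln_ge0; rewrite ler1n -(ltr0n R).
apply: (@le_trans _ _ ((ln (#|piece t| ^ k.+1 * N ^ E)%:R)%:E *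
  ((- (k.+1%:R ^+ 2 * ln w))^-1)%:E)%E).
  apply: lee_wpmul2r; first by rewrite lee_fin invr_ge0 ltW.
  have pos : 0 < (#|piece t| ^ k.+1 * N ^ E)%:R :> R.
    by rewrite natrM !natrX mulr_gt0 ?exprn_gt0 // (lt_le_trans ltr01 L1).
  rewrite -lne_EFin // lee_lne; [exact: cov|by rewrite in_itv /= cov0 leey|].
  by rewrite in_itv /= leey lee_fin ltW.
rewrite -EFinM lee_fin natrM !natrX lnM ?posrE ?exprn_gt0 ?(lt_le_trans ltr01 L1) //.
rewrite !lnXn ?(lt_le_trans ltr01 L1) //.
apply: le_trans (_ :
  (ln L *+ k.+1 + k.+1%:R ^+ 2 * (1 + (2 * n)%:R / (2 ^ t)%:R) * ln N%:R) / -
  (k.+1%:R ^+ 2 * ln w) <= _).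
  rewrite ler_pM2r ?invr_gt0 // lerD2l -[ln _ *+ E]mulr_natl ler_wpM2r //.
  exact: net_exponent_le.
have frac1 (F : fieldType) (a B l v : F) : a != 0 -> v != 0 ->
    a ^+ 2 * B * l / (a ^+ 2 * v) = B * l / v by move=> a0 v0; field; apply/andP.
have frac2 (F : fieldType) (a l v : F) : a != 0 -> v != 0 ->
    a * l / (a ^+ 2 * v) = l / (a * v) by move=> a0 v0; field; apply/andP.
have k_neq0 := lt0r_neq0 k0; have lnw_neq0 := lt0r_neq0 lnw.
rewrite -mulrN mulrDl addrC; apply: lerD;
  first by rewrite (frac1 R _ _ _ _ k_neq0 lnw_neq0).
by apply: le_trans kth; rewrite -[ln L *+ _]mulr_natl (frac2 R _ _ _ k_neq0 lnw_neq0).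
Unshelve. all: by end_near.
Qed.

Theorem theorem4p1 (R : realType) (A : cstarType R) (n : nat) (x : 'I_n -> A)
    (p : nat -> ncpoly R n)
    (p_enum : range p = rational_ncpoly R n)
    (A_sep : separable A)
    (A_appdiv : approximately_divisible A)
    (x_sa : forall i : 'I_n, star (x i) = x i)
    (x_gen : generated_by x) :
  (delta_top p x <= 1%:E)%E.
Proof.
apply/lee_addgt0Pr => th th0; rewrite -EFinD; apply: limf_esup_le.
pose c := \sum_i cnorm (x i) + 2.
have c0 : 0 < c.
  by rewrite ltr_wpDl // sumr_ge0 // => i _; exact: cnorm_ge0.
pose h := Num.min 1 (th / 3).
have h0 : 0 < h by rewrite lt_min ltr01 divr_gt0.
have h1 : h <= 1 by rewrite ge_min lexx.
have h3 : h <= th / 3 by rewrite ge_min lexx orbT.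
(* The number [2 ^ t] of copies is fixed before [w], as the bound on the net is
   uniform in it. *)
have [t tP] : exists t : nat, (2 * n)%:R / (2 ^ t)%:R <= h.
  pose u := (Num.trunc ((2 * n)%:R / h)).+1; exists u.
  rewrite ler_pdivrMr ?ltr0n ?expn_gt0 // mulrC -ler_pdivrMr //.
  apply: (@le_trans _ _ u%:R); first by apply/ltW; exact: truncnS_gt.
  by rewrite ler_nat ltnW // ltn_expl.
pose C1 := 300 * c + 1.
have C11 : 1 <= C1 by rewrite /C1 lerDr; apply: mulr_ge0 (ler0n _ _) (ltW c0).
have lnC : 0 <= ln C1 by exact: ln_ge0.
near=> w.
have w0 : 0 < w by near: w; exact: nbhs_right_gt.
have w1 : w < 1 by near: w; apply: nbhs_right_lt.
have wC : ln C1 <= h * - ln w.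
  have : w < expR (- (ln C1 / h)) by near: w; apply: nbhs_right_lt; exact: expR_gt0.
  rewrite -ltr_ln ?posrE ?expR_gt0 // expRK => /ltW; rewrite lerNr => hw.
  by rewrite mulrC -ler_pdivrMr.
have lnw : 0 < - ln w by rewrite oppr_gt0 ln_lt0 // w0.
(* This choice makes [N <= C1 / w], with [C1] independent of [w] and [t]. *)
pose N := (Num.trunc (300 * c / w)).+1.
have wN : 6 / (w / (50 * c)) <= N%:R.
  have -> : 6 / (w / (50 * c)) = 300 * c / w by field; rewrite !gt_eqF.
  by apply/ltW; exact: truncnS_gt.
apply: le_trans (delta_top_at_le t p_enum A_appdiv x_sa x_gen w0 w1 wN) _.
rewrite lee_fin ler_pdivrMr //.
have NC : ln N%:R <= ln C1 - ln w.
  rewrite -ln_div ?posrE ?(lt_le_trans ltr01 C11) //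
    ler_ln ?posrE ?divr_gt0 ?ltr0n ?(lt_le_trans ltr01 C11) //.
  rewrite /C1 mulrDl mul1r /N -natr1; apply: lerD; last by rewrite invf_ge1 // ltW.
  by rewrite truncn_le; apply: divr_ge0 (ltW w0); apply: mulr_ge0 (ler0n _ _) (ltW c0).
have lnN0 : 0 <= ln N%:R :> R by apply: ln_ge0; rewrite ler1n.
apply: (@le_trans _ _ ((1 + h) * ((1 + h) * - ln w))).
  apply: ler_pM.
  - by apply: addr_ge0 => //; apply: divr_ge0.
  - exact: lnN0.
  - by rewrite lerD2l.
  - by apply: le_trans NC _; rewrite mulrDl mul1r addrC lerD2l.
rewrite mulrA ler_pM2r //; clear -h0 h1 h3.
nra.
Unshelve. all: by end_near.
Qed.
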